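(* Let $M$ be a compact metric space, $\sigma:M\to M$ a continuous map, and let $F:M\times\mathbb{P}^k\to M\times\mathbb{P}^k$, $F(\lambda,z)=(\sigma(\lambda),f_\lambda(z))$, where each $f_\lambda$ is a holomorphic endomorphism of $\mathbb{P}^k$ of fixed degree $d\ge2$ that depends continuously on $\lambda$, with corresponding non-degenerate homogeneous holomorphic maps $F_\lambda:\mathbb{C}^{k+1}\to\mathbb{C}^{k+1}$ (as in the context). For each $\lambda\in M$, the sequence $G_{n,\lambda}$ converges uniformly on $\mathbb{C}^{k+1}$, as $n\to\infty$, to a continuous plurisubharmonic function $G_\lambda$ which satisfies $$G_\lambda(cx)=\log|c|+G_\lambda(x)$$ for $c\in\mathbb{C}^*$. Further, $d\,G_\lambda=G_{\sigma(\lambda)}\circ F_\lambda$, and $G_{\lambda_n}\to G_\lambda$ locally uniformly on $\mathbb{C}^{k+1}\setminus\{0\}$ as $\lambda_n\to\lambda$ in $M$. Finally, $$\mathcal{A}_\lambda=\{x\in\mathbb{C}^{k+1}:G_\lambda(x)<0\}$$ for each $\lambda\in M$.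
   Context: Let $\pi:\mathbb{C}^{k+1}\setminus\{0\}\to\mathbb{P}^k$ be the canonical projection. Corresponding to each $f_\lambda$ there exists a non-degenerate homogeneous holomorphic mapping $F_\lambda:\mathbb{C}^{k+1}\to\mathbb{C}^{k+1}$ such that $\pi\circ F_\lambda=f_\lambda\circ\pi$. Here non-degeneracy means that $F_\lambda^{-1}(0)=\{0\}$, which in turn implies that there are uniform constants $l,L>0$ with $l\|x\|^d\le\|F_\lambda(x)\|\le L\|x\|^d$ for all $\lambda\in M$ and $x\in\mathbb{C}^{k+1}$. The basin of attraction at $\lambda\in M$ is $$\mathcal{A}_\lambda=\{x\in\mathbb{C}^{k+1}:F_{\sigma^{n-1}(\lambda)}\circ\cdots\circ F_{\sigma(\lambda)}\circ F_\lambda(x)\to0\text{ as }n\to\infty\}.$$ For each $\lambda\in M$ and $n\ge1$, $$G_{n,\lambda}(x)=\frac{1}{d^n}\log\|F_{\sigma^{n-1}(\lambda)}\circ\cdots\circ F_{\sigma(\lambda)}\circ F_\lambda(x)\|,$$ with $\log 0=-\infty$, so that $G_\lambda(0)=-\infty$.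
   Formalization: The lifts F_λ are assumed chosen so that ‖F_λ(x)‖ is jointly continuous in (λ,x); for arbitrary lifts, e.g. rescaled by a discontinuous c(λ), the convergence G_{λ_n} → G_λ fails. *)

(* Defs.v *)
From HB Require Import structures.
From mathcomp Require Export all_boot all_order all_algebra.
From mathcomp Require Export generic_quotient complex.
From mathcomp Require Export all_classical all_reals all_analysis.
Export Order.TTheory GRing.Theory Num.Theory.
Export numFieldNormedType.Exports.

Set Implicit Arguments.
Unset Strict Implicit.
Unset Printing Implicit Defensive.

Local Open Scope classical_set_scope.
Local Open Scope ring_scope.
Local Open Scope complex_scope.
Local Open Scope quotient_scope.

(* R[i] bundled as a numClosedFieldType: the topology and the normed module
   structure of the library are attached to such a structure, not to the bare
   type R[i]. *)
Definition Cfield (R : realType) : numClosedFieldType := R[i].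

Notation Cvec R k := ('rV[Cfield R]_k.+1).

Section ProjectiveSpace.
Variables (R : realType) (k : nat).

Definition nonzero : topologicalType :=
  set_type [set x : Cvec R k | x != 0].

Definition collinear (x y : nonzero) : bool :=
  `[< exists2 c : Cfield R, c != 0 & val x = c *: val y >].

Lemma collinear_refl : reflexive collinear.
Proof. by move=> x; apply/asboolP; exists 1; rewrite ?oner_neq0 ?scale1r. Qed.

Lemma collinear_sym : symmetric collinear.
Proof.
move=> x y; apply/asboolP/asboolP => -[c c0 e]; exists c^-1;
  by rewrite ?invr_neq0// e scalerA mulVf// scale1r.
Qed.

Lemma collinear_trans : transitive collinear.
Proof.
move=> y x z /asboolP[a a0 xy] /asboolP[b b0 yz]; apply/asboolP.
by exists (a * b); rewrite ?mulf_neq0// xy yz scalerA.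
Qed.

Canonical collinear_equiv :=
  EquivRel collinear collinear_refl collinear_sym collinear_trans.

Definition projspace : topologicalType :=
  quotient_topology {eq_quot collinear}.

Definition proj (x : nonzero) : projspace := \pi_({eq_quot collinear}) x.

(* Holomorphy of a self-map of P^k, tested after composing with the
   holomorphic submersion proj and through local holomorphic lifts. *)
Definition holomorphic_endo (f : projspace -> projspace) : Prop :=
  forall x : nonzero, exists2 phi : Cvec R k -> Cvec R k,
    (\forall y \near (val x : Cvec R k), differentiable phi y) &
    (\forall y \near x, exists2 z : nonzero,
        val z = phi (val y) & f (proj y) = proj z).

(* [differentiable] is over the field Cfield R, i.e. complex differentiability.
   The degree of f is the degree of homogeneity of such an F. *)
Record homogeneous_lift (d : nat) (f : projspace -> projspace)
    (F : Cvec R k -> Cvec R k) : Prop := HomogeneousLift {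
  lift_holomorphic : forall x, differentiable F x ;
  lift_homogeneous : forall (c : Cfield R) x, F (c *: x) = c ^+ d *: F x ;
  lift_nondegenerate : F @^-1` [set 0] = [set 0] ;
  lift_proj : forall x y : nonzero, val y = F (val x) -> proj y = f (proj x)
}.

End ProjectiveSpace.

Section Green.
Variables (R : realType) (k : nat).
Local Notation V := (Cvec R k).

Definition eucl_norm (x : V) : R := Num.sqrt (\sum_i Normc.normc (x 0 i : R[i]) ^+ 2).

Definition fiber_iter (M : Type) (sigma : M -> M) (F : M -> V -> V)
    (lam : M) (n : nat) (x : V) : V :=
  iteri n (fun j => F (iter j sigma lam)) x.

(* The library's [lne] sends 0 to -oo. *)
Definition green_approx (M : Type) (sigma : M -> M) (F : M -> V -> V) (d : nat)
    (n : nat) (lam : M) (x : V) : \bar R :=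
  ((d%:R ^+ n)^-1)%:E * lne (eucl_norm (fiber_iter sigma F lam n x))%:E.

Definition basin (M : Type) (sigma : M -> M) (F : M -> V -> V) (lam : M) :
    set V :=
  [set x | fiber_iter sigma F lam n x @[n --> \oo] --> (0 : V)].

(* |u_n - g| <= e on A, written without subtraction so that at a point where
   one of the two functions is -oo the other one must be -oo as well. *)
Definition uniform_cvg_on (A : set V) (u : nat -> V -> \bar R)
    (g : V -> \bar R) : Prop :=
  forall e : R, 0 < e -> \forall n \near \oo,
    forall x, A x -> (u n x <= g x + e%:E)%E /\ (g x <= u n x + e%:E)%E.

Definition locally_uniform_cvg_on (A : set V) (u : nat -> V -> \bar R)
    (g : V -> \bar R) : Prop :=
  forall x, A x -> exists2 U, nbhs x U & uniform_cvg_on (U `&` A) u g.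

(* Plurisubharmonic on all of C^(k+1): upper semicontinuous with values in
   [-oo, +oo), not identically -oo, and with the sub-mean value property on
   every circle of every complex line. *)
Record plurisubharmonic (u : V -> \bar R) : Prop := Plurisubharmonic {
  psh_lty : forall x, (u x < +oo)%E ;
  psh_neqNy : exists x, u x != -oo%E ;
  psh_usc : lower_semicontinuous (fun x => - u x)%E ;
  psh_submean : forall a b : V,
    (u a <= ((2 * pi)^-1)%:E *
      \int[lebesgue_measure]_(t in `[0%R, (2 * pi)%R])
        u (a + (cos t +i* sin t : Cfield R)%C *: b)%R)%E
}.

End Green.

(* Main.v *)
Require Import Defs.
From mathcomp Require Import measurable_realfun ring lra.

(** Dynamics.  Non-degeneracy and compactness of M x {|x| = 1} bound
    phi (lam, [x]) = ln |F_lam x| - d ln |x|, which by homogeneity is a function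
    on M x P^k ([distortion_line], [distortion_bounded]).  It is continuous there
    because the projection is open ([continuous_on_projspace]).  The skew
    product T (lam, z) = (sigma lam, f_lam z) is continuous, so the series
    g = sum of phi (T^n) / d^(n+1) converges uniformly to a bounded continuous
    solution of d g = phi + g o T ([cohomological_equation]).  Put
    G_lam x = ln |x| + g (lam, [x]), and G_lam 0 = -oo.  Then
    d G_lam = G_(sigma lam) o F_lam, and iterating this relation gives
      | ln |F^n_lam x| - d^n G_lam x | <= sup |g|     ([ln_fiber_iter_approx]),
    which contains both the uniform convergence of the G_n and the description
    of the basin.  Continuity in lam is obtained from that of g, uniformly on
    the compact unit sphere.  Going through P^k matters: the lift F_lam x itself
    need not be continuous in lam, as only its modulus is.

    Plurisubharmonicity.  What has to be shown is the sub-mean value property of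
    G_lam on a circle t |-> a + e^(it) b.  Let h (z) = F^n_lam (a + z b), a
    holomorphic map to C^(k+1), and let w be a primitive N-th root of unity.
    The scalar entire function
      z |-> product over j < N of < h 0, h (w^j z) >
    takes the value |h 0|^(2N) at 0, so the maximum principle and the
    Cauchy-Schwarz inequality provide an angle t with
      N ln |h 0| <= sum over j < N of ln |h (w^j e^(it))|
    up to an arbitrarily small error ([discrete_jensen]).  Dividing by N d^n and
    letting n grow, G_lam a is at most a Riemann sum of G_lam along the circle,
    with N equidistant nodes; letting N grow, these sums tend to the mean,
    uniformly in t, for the continuous truncations max (G_lam, -K)
    ([riemann_mean_le_integral]).  Monotone convergence as K grows removes the
    truncation ([submean_of_truncations]).

    Maximum principle.  A holomorphic function is only known to have a
    derivative at each point, so Cauchy's theorem is proved by Goursat's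
    bisection argument.  It is applied in logarithmic polar coordinates
    (s, t) |-> e^s e^(it): on the rectangle [s0, 0] x [0, 2 pi] the horizontal
    sides cancel by periodicity, so the circles of radii e^s0 and 1 have the
    same mean ([goursat_rectangle], [periodic_real_part_value],
    [maximum_principle]). *)

Set Implicit Arguments.
Unset Strict Implicit.
Unset Printing Implicit Defensive.

Local Open Scope classical_set_scope.
Local Open Scope ring_scope.
Import Normc.

(** * Moduli of complex numbers and the Euclidean norm *)

Section ComplexTopology.
Variable R : realType.
Local Notation C := (Cfield R).
Implicit Types (z w : C).

Lemma normE z : `|z| = (normc (z : R[i]))%:C%C :> R[i].
Proof. by case: z => a b; rewrite normc_def. Qed.

Lemma normc_ge0 z : 0 <= normc z.
Proof. by case: z => a b; exact: sqrtr_ge0. Qed.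

Lemma normc_gt0 z : (0 < normc z) = (z != 0).
Proof.
rewrite lt_neqAle normc_ge0 andbT eq_sym; congr (~~ _).
apply/eqP/eqP => [/eq0_normc//|->]; exact: normc0.
Qed.

Lemma normcX z n : normc (z ^+ n) = normc z ^+ n.
Proof. by elim: n => [|n IH]; rewrite ?expr0 ?normc1// !exprS normcM IH. Qed.

Lemma normcR (r : R) : normc (r%:C)%C = `|r|.
Proof. by rewrite /normc /= expr0n /= addr0 sqrtr_sqr. Qed.

Lemma Re_le_normc z : `|complex.Re (z : R[i])| <= normc z.
Proof.
case: z => a b /=; rewrite -sqrtr_sqr ler_sqrt ?lerDl ?sqr_ge0//.
by rewrite addr_ge0// sqr_ge0.
Qed.

Lemma Im_le_normc z : `|complex.Im (z : R[i])| <= normc z.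
Proof.
case: z => a b /=; rewrite -sqrtr_sqr ler_sqrt ?lerDr ?sqr_ge0//.
by rewrite addr_ge0// sqr_ge0.
Qed.

Lemma normc_le_ReIm z :
  normc z <= `|complex.Re (z : R[i])| + `|complex.Im (z : R[i])|.
Proof.
case: z => a b /=; rewrite -[leRHS]ger0_norm ?addr_ge0// -sqrtr_sqr.
rewrite ler_sqrt ?sqr_ge0// sqrrD !real_normK ?num_real//.
by rewrite lerD2r lerDl mulrn_wge0// mulr_ge0.
Qed.

Lemma normcB z w : normc (z - w) = normc (w - z).
Proof. by rewrite -normcN opprB. Qed.

Lemma ler_normc_dist z w : `|normc z - normc w| <= normc (z - w).
Proof.
rewrite ler_norml; apply/andP; split.
  rewrite lerNl opprB lerBlDr normcB.
  by rewrite (le_trans _ (le_normcD _ _))// subrK.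
by rewrite lerBlDr (le_trans _ (le_normcD _ _))// subrK.
Qed.

Lemma near_normcP z (P : set C) :
  nbhs z P <-> exists2 e : R, 0 < e & forall w, normc (w - z) < e -> P w.
Proof.
split=> [/nbhs_ballP[e /= e0 eP]|[e e0 eP]].
  have [e' eE] : exists e' : R, e = (e'%:C)%C.
    exists (complex.Re (e : R[i])); rewrite RRe_real//.
    exact: (@gtr0_real R[i]).
  exists e'; first by rewrite -(ltcR 0 e') -eE.
  move=> w wz; apply: eP; rewrite -ball_normE /ball_ /= eE.
  rewrite normE normcB.
  by rewrite -ltcR in wz.
apply/nbhs_ballP; exists (e%:C)%C; first by rewrite /= ltcR.
move=> w; rewrite -ball_normE /ball_ /= => wz; apply: eP.
by rewrite normcB -ltcR -normE.
Qed.

Lemma normc_continuous : continuous (fun z : C => normc (z : R[i])).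
Proof.
move=> z A /nbhs_ballP[e /= e0 eA]; apply/near_normcP; exists e => // w wz.
apply: eA; rewrite -ball_normE /ball_ /=; apply: le_lt_trans wz.
by rewrite normcB ler_normc_dist.
Qed.

Lemma continuous_Complex (T : topologicalType) (f g : T -> R) :
  continuous f -> continuous g ->
  continuous (fun t => Complex (f t) (g t) : C).
Proof.
move=> cf cg t A /near_normcP[e e0 eA].
have e20 : 0 < e / 2 by rewrite divr_gt0.
suff: \forall u \near t, A (Complex (f u) (g u) : C) by [].
near=> u; apply: eA.
apply: (le_lt_trans (normc_le_ReIm _)) => /=.
have fu : `|f t - f u| < e / 2 by near: u; move/cvgrPdist_lt: (cf t); apply.
have gu : `|g t - g u| < e / 2 by near: u; move/cvgrPdist_lt: (cg t); apply.
by rewrite [ltRHS]splitr ltrD// distrC.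
Unshelve. all: by end_near. Qed.

End ComplexTopology.

Section EuclideanNorm.
Variables (R : realType) (k : nat).
Local Notation C := (Cfield R).
Local Notation V := (Cvec R k).
Implicit Types x y : V.

Lemma normc_sum (I : Type) (r : seq I) (h : I -> R[i]) :
  normc (\sum_(i <- r) h i) <= \sum_(i <- r) normc (h i).
Proof.
elim/big_ind2 : _ => [|a b c d ab cd|//]; first by rewrite normc0.
exact: le_trans (le_normcD _ _) (lerD ab cd).
Qed.

Lemma normc_prod (I : Type) (r : seq I) (h : I -> R[i]) :
  normc (\prod_(i <- r) h i) = \prod_(i <- r) normc (h i).
Proof. exact: (big_morph _ (@normcM R) (@normc1 R)). Qed.

Lemma eucl_norm_ge0 x : 0 <= eucl_norm x.
Proof. exact: sqrtr_ge0. Qed.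

Let sumsq_ge0 x : 0 <= \sum_i normc (x 0 i : R[i]) ^+ 2.
Proof. by apply: sumr_ge0 => i _; exact: sqr_ge0. Qed.

Lemma eucl_norm_sqr x :
  eucl_norm x ^+ 2 = \sum_i normc (x 0 i : R[i]) ^+ 2.
Proof. by rewrite sqr_sqrtr. Qed.

Lemma eucl_norm_eq0 x : (eucl_norm x == 0) = (x == 0).
Proof.
apply/eqP/eqP => [x0|->]; last first.
  rewrite /eucl_norm big1 ?sqrtr0// => i _.
  by rewrite mxE normc0 expr0n.
apply/rowP => i; rewrite mxE; apply: eq0_normc; apply/eqP.
rewrite -sqrf_eq0; apply/eqP.
have /eqP := eucl_norm_sqr x; rewrite x0 expr0n eq_sym psumr_eq0; last first.
  by move=> j _; exact: sqr_ge0.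
by move=> /allP/(_ i); rewrite mem_index_enum => /(_ isT)/eqP.
Qed.

Lemma eucl_norm_gt0 x : (0 < eucl_norm x) = (x != 0).
Proof. by rewrite lt_neqAle eucl_norm_ge0 andbT eq_sym eucl_norm_eq0. Qed.

Lemma eucl_norm0 : eucl_norm (0 : V) = 0.
Proof. by apply/eqP; rewrite eucl_norm_eq0. Qed.

Lemma eucl_normZ (c : C) x : eucl_norm (c *: x) = normc (c : R[i]) * eucl_norm x.
Proof.
rewrite /eucl_norm -[in RHS](ger0_norm (normc_ge0 c)) -sqrtr_sqr -sqrtrM ?sqr_ge0//.
by congr Num.sqrt; rewrite mulr_sumr; apply: eq_bigr => i _; rewrite mxE normcM exprMn.
Qed.

Lemma normc_le_eucl x i : normc (x 0 i : R[i]) <= eucl_norm x.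
Proof.
rewrite -(@ger0_norm _ (normc _)) ?(@normc_ge0 R)// -sqrtr_sqr ler_sqrt//.
by rewrite (bigD1 i)//= lerDl sumr_ge0// => j _; exact: sqr_ge0.
Qed.

Lemma eucl_norm_continuous : continuous (@eucl_norm R k).
Proof.
move=> x; rewrite /eucl_norm.
apply: (@continuous_comp _ _ _ (fun x : V => \sum_i normc (x 0 i : R[i]) ^+ 2)
  Num.sqrt); last exact: sqrt_continuous.
move: x; apply: (continuous_big add_continuous) => i _ x.
have h : {for x, continuous (fun x : V => normc (x 0 i : R[i]))}.
  apply: (@continuous_comp _ _ _ (fun x : V => x 0 i) (fun z : C => normc (z : R[i]))).
    exact: coord_continuous.
  exact: normc_continuous.
by under eq_fun do rewrite expr2; exact: (cvgM h h).
Qed.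

Definition hdot x y : R[i] := \sum_i conjc (x 0 i : R[i]) * (y 0 i : R[i]).

Lemma hdot_self x : normc (hdot x x) = eucl_norm x ^+ 2.
Proof.
rewrite eucl_norm_sqr.
have -> : hdot x x = (\sum_i normc (x 0 i : R[i]) ^+ 2)%:C%C.
  rewrite /hdot rmorph_sum; apply: eq_bigr => i _; case: (x 0 i) => a b.
  rewrite /= sqr_sqrtr ?addr_ge0 ?sqr_ge0//.
  by apply/eqP; rewrite eq_complex /=; apply/andP; split; apply/eqP; ring.
by rewrite normcR ger0_norm.
Qed.

Lemma cauchy_schwarz_hdot x y :
  normc (hdot x y) <= eucl_norm x * eucl_norm y.
Proof.
have [->|x0] := eqVneq x 0.
  rewrite eucl_norm0 mul0r /hdot big1 ?normc0// => i _.
  by rewrite mxE conjc0 mul0r.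
have [->|y0] := eqVneq y 0.
  rewrite eucl_norm0 mulr0 /hdot big1 ?normc0// => i _.
  by rewrite mxE mulr0.
move: x0 y0; rewrite -!eucl_norm_gt0 => x0 y0.
apply: le_trans (normc_sum _ _) _.
pose r := eucl_norm y / eucl_norm x.
have r0 : 0 < r by rewrite divr_gt0.
(* x_i y_i <= (r x_i^2 + y_i^2 / r) / 2, with r chosen so that the two sums agree *)
apply: (@le_trans _ _ (\sum_i (r / 2 * normc (x 0 i : R[i]) ^+ 2 +
    (2 * r)^-1 * normc (y 0 i : R[i]) ^+ 2))).
  apply: ler_sum => i _; rewrite normcM.
  have -> : normc (conjc (x 0 i : R[i])) = normc (x 0 i : R[i]).
    by case: (x 0 i) => a b /=; rewrite sqrrN.
  set a := normc _; set b := normc _.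
  have : 0 <= (2 * r)^-1 * (r * a - b) ^+ 2.
    by rewrite mulr_ge0 ?sqr_ge0// invr_ge0 mulr_ge0// ltW.
  rewrite (_ : (2 * r)^-1 * (r * a - b) ^+ 2 =
    r / 2 * a ^+ 2 + (2 * r)^-1 * b ^+ 2 - a * b); first by lra.
  by field; rewrite gt_eqF.
rewrite big_split/= -!mulr_sumr -!eucl_norm_sqr /r.
rewrite le_eqVlt; apply/orP; left; apply/eqP.
by field; rewrite !gt_eqF.
Qed.

Lemma hdotDZr x y (c : C) z :
  hdot x (y + c *: z) = hdot x y + (c : R[i]) * hdot x z.
Proof.
rewrite /hdot mulr_sumr -big_split; apply: eq_bigr => i _ /=.
by rewrite !mxE mulrDr mulrCA.
Qed.

(** From |z|^2 = <z, x> + c <z, y> with z = x + c y, and Cauchy-Schwarz. *)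
Lemma eucl_normDZ x y (c : C) :
  eucl_norm (x + c *: y) <= eucl_norm x + normc (c : R[i]) * eucl_norm y.
Proof.
set z := x + c *: y; have [z0|z0] := eqVneq z 0.
  by rewrite z0 eucl_norm0 addr_ge0 ?mulr_ge0 ?eucl_norm_ge0 ?(@normc_ge0 R).
have nz : 0 < eucl_norm z by rewrite eucl_norm_gt0.
rewrite -(ler_pM2l nz) -expr2 -hdot_self {2}/z hdotDZr.
apply: le_trans (le_normcD _ _) _; rewrite mulrDr; apply: lerD.
  exact: cauchy_schwarz_hdot.
rewrite normcM mulrCA ler_wpM2l ?(@normc_ge0 R)//.
exact: cauchy_schwarz_hdot.
Qed.

Lemma nbhs0_eucl (A : set V) : nbhs (0 : V) A ->
  exists2 e : R, 0 < e & forall x : V, eucl_norm x < e -> A x.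
Proof.
move=> /nbhs_ballP[e /= e0 eA].
have [r er] : exists r : R, e = r%:C%C.
  by exists (complex.Re (e : R[i])); rewrite RRe_real//; exact: (@gtr0_real R[i]).
exists r; first by rewrite -(ltcR 0 r) -er.
move=> x xr; apply: eA; split=> // i j; rewrite ord1 mxE.
rewrite -ball_normE /ball_ /= sub0r normrN er normE ltcR.
exact: le_lt_trans (normc_le_eucl x j) xr.
Qed.

End EuclideanNorm.

(** * Primitives and bisection of rectangles *)

Section Primitive.
Variable R : realType.

(** A primitive of a continuous [f], on the half-line to the right of [a]. *)
Definition prim (a : R) (f : R -> R) (x : R) : R :=
  (\int[lebesgue_measure]_(t in `[a, x]) f t)%R.

Lemma is_derive_prim (a : R) (f : R -> R) (x : R) : continuous f -> a < x ->
  is_derive x 1 (prim a f) (f x).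
Proof.
move=> cf ax.
have xx1 : x < x + 1 by rewrite ltrDl.
have [|] := @continuous_FTC1_closed R f a x (x + 1) xx1 _ ax (cf x).
  apply: continuous_compact_integrable; first exact: segment_compact.
  exact: continuous_subspaceT.
by move=> df <-; rewrite derive1E; exact/derivableP.
Qed.

Lemma increment_le (P f : R -> R) (x y c m : R) : x <= y ->
  (forall t, x <= t <= y -> is_derive t 1 P (f t)) ->
  (forall t, x <= t <= y -> `|f t - c| <= m) ->
  `|P y - P x - c * (y - x)| <= m * (y - x).
Proof.
move=> xy dP fc.
have [||t txy ->] := @MVT_segment R P f x y xy.
- by move=> t /[!in_itv]/= /andP[xt ty]; apply: dP; rewrite !ltW.
- apply: derivable_within_continuous => t /[!in_itv]/= txy.
  by have [] := dP _ txy.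
rewrite -mulrBl normrM [X in _ * X]ger0_norm ?subr_ge0//.
by rewrite ler_wpM2r ?subr_ge0// fc// -in_itv.
Qed.

Lemma nested_halving (r : nat -> R) (c : R) : 0 < c ->
  (forall n, r n <= r n.+1 <= r n + c / 2 ^+ n.+1) ->
  exists2 l, (forall n, r 0%N <= r n) &
    forall n, r n <= l <= r n + c / 2 ^+ n.
Proof.
move=> c0 rS.
have rle n m : (n <= m)%N -> r n <= r m /\ r m + c / 2 ^+ m <= r n + c / 2 ^+ n.
  move=> /subnK <-; elim: (m - n)%N => [//|k [IH1 IH2]]; rewrite addSn.
  have /andP[h1 h2] := rS (k + n)%N; split; first exact: le_trans h1.
  apply: le_trans IH2; apply: le_trans (lerD h2 (lexx _)) _.
  rewrite -addrA lerD2l exprS.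
  by rewrite le_eqVlt; apply/orP; left; apply/eqP; field; rewrite expf_neq0.
have rb n m : r m <= r n + c / 2 ^+ n.
  have c2 k : 0 <= c / 2 ^+ k by rewrite divr_ge0// ltW.
  have [nm|mn] := leP n m.
    by apply: le_trans (rle _ _ nm).2; rewrite lerDl.
  by apply: le_trans (rle _ _ (ltnW mn)).1 _; rewrite lerDl.
exists (sup (range r)) => n; first by have [] := rle 0%N n (leq0n _).
apply/andP; split.
  by apply: ub_le_sup; [exists (r 0%N + c / 2 ^+ 0) => _ [m _ <-]|exists n].
by apply: ge_sup => [|_ [m _ <-]//]; exists (r 0%N), 0%N.
Qed.

(** Goursat's argument: if an additive function of rectangles did not vanish on
    some rectangle, quartering the latter repeatedly would keep at least the
    mean share K / 4^n of its modulus K in some nested sequence of rectangles,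
    against the assumption of a small density at their common point. *)
Lemma quadrisection (Phi : R -> R -> R -> R -> R) (s0 t0 a b : R) :
  0 < a -> 0 < b ->
  (forall s t x y, Phi s t (x + x) (y + y) =
     Phi s t x y + Phi (s + x) t x y + Phi s (t + y) x y +
     Phi (s + x) (t + y) x y) ->
  (forall s t e : R, s0 <= s -> t0 <= t -> 0 < e -> exists2 d : R, 0 < d &
     forall s' t' x y : R, s0 <= s' -> t0 <= t' -> 0 < x < d -> 0 < y < d ->
       s' <= s <= s' + x -> t' <= t <= t' + y ->
       `|Phi s' t' x y| <= e * (x + y) ^+ 2) ->
  Phi s0 t0 a b = 0.
Proof.
move=> a0 b0 add loc; apply: contrapT => /eqP; rewrite -normr_gt0.
set K := `|_| => K0.
pose inv (p : nat * (R * R)) := K / 4 ^+ p.1 <=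
  `|Phi p.2.1 p.2.2 (a / 2 ^+ p.1) (b / 2 ^+ p.1)|.
pose next (p q : nat * (R * R)) := [/\ q.1 = p.1.+1,
  p.2.1 <= q.2.1 <= p.2.1 + a / 2 ^+ q.1 &
  p.2.2 <= q.2.2 <= p.2.2 + b / 2 ^+ q.1].
have step (p : {p | inv p}) : {q : {p | inv p} | next (sval p) (sval q)}.
  apply: cid; case: p => -[n [s t]] /=; rewrite /inv/= => Kn.
  set x := a / 2 ^+ n.+1; set y := b / 2 ^+ n.+1.
  have x0 : 0 <= x by rewrite divr_ge0// ltW.
  have y0 : 0 <= y by rewrite divr_ge0// ltW.
  have split2 (c : R) : c / 2 ^+ n = c / 2 ^+ n.+1 + c / 2 ^+ n.+1.
    by rewrite exprS; field; rewrite expf_neq0.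
  have split4 : K / 4 ^+ n = K / 4 ^+ n.+1 *+ 4.
    by rewrite exprS -mulr_natr; field; rewrite expf_neq0.
  move: Kn; rewrite (split2 a) (split2 b) add split4 -/x -/y => Kn.
  have [s' [t' [Hs Ht]]] : exists s' t', [/\ s <= s' <= s + x, t <= t' <= t + y &
      K / 4 ^+ n.+1 <= `|Phi s' t' x y|].
    apply: contrapT => H.
    have Hle s' t' : s <= s' <= s + x -> t <= t' <= t + y ->
        `|Phi s' t' x y| < K / 4 ^+ n.+1.
      by move=> ? ?; rewrite ltNge; apply/negP => ?; apply: H; exists s', t'.
    have sb : s <= s <= s + x by rewrite lexx lerDl.
    have sb' : s <= s + x <= s + x by rewrite lexx lerDl x0.
    have tb : t <= t <= t + y by rewrite lexx lerDl.
    have tb' : t <= t + y <= t + y by rewrite lexx lerDl y0.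
    have := le_lt_trans (ler_normD _ _) (ltrD (le_lt_trans (ler_normD _ _)
      (ltrD (le_lt_trans (ler_normD _ _)
      (ltrD (Hle _ _ sb tb) (Hle _ _ sb' tb))) (Hle _ _ sb tb')))
      (Hle _ _ sb' tb')).
    by move=> /(le_lt_trans Kn); lra.
  by move=> Kn'; exists (exist _ (n.+1, (s', t')) Kn').
have inv0 : inv (0%N, (s0, t0)) by rewrite /inv /= !expr0 !divr1.
have [u [u0 uS]] := @dependent_choice _ _ step (exist (fun p => inv p) _ inv0).
pose s n := (sval (u n)).2.1; pose t n := (sval (u n)).2.2.
have uE n : (sval (u n)).1 = n.
  by elim: n => [|n IH]; [rewrite u0|have [-> _ _] := uS n; rewrite IH].
have uinv n : K / 4 ^+ n <= `|Phi (s n) (t n) (a / 2 ^+ n) (b / 2 ^+ n)|.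
  by have := svalP (u n); rewrite /inv uE.
have [|ls s_ge ls_in] := @nested_halving s a a0.
  by move=> n; have [_ + _] := uS n; rewrite uE.
have [|lt t_ge lt_in] := @nested_halving t b b0.
  by move=> n; have [_ _ +] := uS n; rewrite uE.
have s00 : s 0%N = s0 by rewrite /s u0.
have t00 : t 0%N = t0 by rewrite /t u0.
rewrite s00 in s_ge; rewrite t00 in t_ge.
pose e := K / (2 * (a + b) ^+ 2).
have ab2 : 0 < (a + b) ^+ 2 by rewrite exprn_gt0// addr_gt0.
have e0 : 0 < e by rewrite divr_gt0// mulr_gt0.
have [||d d0 small] := loc ls lt e _ _ e0.
- by rewrite -s00; have /andP[] := ls_in 0%N.
- by rewrite -t00; have /andP[] := lt_in 0%N.
have [n nab] : exists n, (a + b) / 2 ^+ n < d.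
  have h : (a + b) * (2^-1) ^+ n @[n --> \oo] --> (0 : R).
    rewrite -(mulr0 (a + b)); apply: cvgMr; apply: cvg_expr.
    by rewrite ger0_norm// invf_lt1// ltr1n.
  have [n _ /(_ n (leqnn n)) /=] : \forall n \near \oo, (a + b) * (2^-1) ^+ n < d.
    exact: cvgr_lt h _ d0.
  by rewrite exprVn => ?; exists n.
have an0 : 0 < a / 2 ^+ n by rewrite divr_gt0.
have bn0 : 0 < b / 2 ^+ n by rewrite divr_gt0.
have := le_trans (uinv n) (small _ _ _ _ (s_ge n) (t_ge n) _ _ (ls_in n) (lt_in n)).
rewrite an0 bn0 -mulrDl => /(_ _ _).
rewrite leNgt => /(_ _ _)/negP[].
- by apply: le_lt_trans nab; rewrite ler_wpM2r// lerDl ltW.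
- by apply: le_lt_trans nab; rewrite ler_wpM2r// lerDr ltW.
have -> : e * ((a + b) / 2 ^+ n) ^+ 2 = K / 4 ^+ n / 2.
  rewrite /e exprMn exprVn -exprM mulnC exprM (_ : 2 ^+ 2 = 4 :> R); last by ring.
  by field; rewrite expf_neq0//= gt_eqF// addr_gt0.
by rewrite ltr_pdivrMr// ltr_pMr ?divr_gt0// ltr1n.
Qed.

End Primitive.

(** * Cauchy's theorem on rectangles and the maximum principle *)

Section Goursat.
Variable R : realType.
Local Notation ReC := (@complex.Re R).
Local Notation ImC := (@complex.Im R).

Let ReB (z w : R[i]) : ReC (z - w) = ReC z - ReC w.
Proof. by case: z w => ? ? []. Qed.

Let ImB (z w : R[i]) : ImC (z - w) = ImC z - ImC w.
Proof. by case: z w => ? ? []. Qed.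

(** Real differentiability of a function of (s, t), with a differential that is
    complex linear in s + i t: the Cauchy-Riemann equations. *)
Definition cr_differentiable (H : R -> R -> R[i]) : Prop :=
  forall s t, exists c : R[i], forall e : R, 0 < e -> exists2 d : R, 0 < d &
    forall x y : R, `|x| < d -> `|y| < d ->
      normc (H (s + x) (t + y) - H s t - c * Complex x y) <= e * (`|x| + `|y|).

Variable H : R -> R -> R[i].
Hypothesis dH : cr_differentiable H.
Local Notation U := (fun s t => ReC (H s t)).
Local Notation V := (fun s t => ImC (H s t)).

Let H_cont s t (e : R) : 0 < e -> exists2 d : R, 0 < d &
  forall x y : R, `|x| < d -> `|y| < d -> normc (H (s + x) (t + y) - H s t) < e.
Proof.
move=> e0; have [c /(_ 1 ltr01)[d d0 Hd]] := dH s t.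
have nc0 := @normc_ge0 R c.
have c0 : 0 < normc c + 2 by lra.
have m0 : 0 < e / (normc c + 2) / 2 by rewrite !divr_gt0.
exists (Num.min d (e / (normc c + 2) / 2)); first by rewrite lt_min d0.
move=> x y; rewrite !lt_min => /andP[xd xe] /andP[yd ye].
have -> : H (s + x) (t + y) - H s t =
    (H (s + x) (t + y) - H s t - c * Complex x y) + c * Complex x y.
  by rewrite subrK.
apply: le_lt_trans (le_normcD _ _) _; rewrite normcM.
have n1 := normc_le_ReIm (Complex x y : Cfield R); rewrite /= in n1.
have n2 : normc c * normc (Complex x y) <= normc c * (`|x| + `|y|).
  by rewrite ler_wpM2l// (@normc_ge0 R c).
have h := Hd x y xd yd.
apply: (@le_lt_trans _ _ ((normc c + 1) * (`|x| + `|y|))); first by lra.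
have -> : e = (normc c + 2) * (e / (normc c + 2)) by field; rewrite gt_eqF.
apply: (@le_lt_trans _ _ ((normc c + 1) * (e / (normc c + 2)))).
  by rewrite ler_wpM2l//; lra.
by rewrite ltr_pM2r ?divr_gt0// ltrD2l ltr1n.
Qed.

Let contU s : continuous (U s).
Proof.
move=> t; apply/cvgrPdist_lt => e e0; have [d d0 Hd] := H_cont s t e0.
apply/nbhs_normP; exists d => //= u; rewrite /= => tu.
have := Hd 0 (u - t); rewrite normr0 addr0 subrKC distrC => /(_ d0 tu).
by apply: le_lt_trans; rewrite distrC -ReB; exact: (@Re_le_normc R).
Qed.

Let contV t : continuous (V ^~ t).
Proof.
move=> s; apply/cvgrPdist_lt => e e0; have [d d0 Hd] := H_cont s t e0.
apply/nbhs_normP; exists d => //= u; rewrite /= => su.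
have := Hd (u - s) 0; rewrite normr0 addr0 subrKC distrC => /(_ su d0).
by apply: le_lt_trans; rewrite distrC -ImB; exact: (@Im_le_normc R).
Qed.

(** With H = U + i V, this is the vanishing of the imaginary part of the integral
    of H (ds + i dt) along the boundary of the rectangle.  The integrals over
    the sides are increments of primitives, which makes them additive under
    subdivision for algebraic reasons. *)
Lemma goursat_rectangle (s0 t0 a b : R) : 0 < a -> 0 < b ->
  let pU s := prim (t0 - 1) (U s) in let pV t := prim (s0 - 1) (V ^~ t) in
  (pU (s0 + a) (t0 + b) - pU (s0 + a) t0) - (pU s0 (t0 + b) - pU s0 t0) =
  (pV (t0 + b) (s0 + a) - pV (t0 + b) s0) - (pV t0 (s0 + a) - pV t0 s0).
Proof.
move=> a0 b0 pU pV; apply/eqP; rewrite -subr_eq0; apply/eqP.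
pose Phi (s t x y : R) :=
  (pU (s + x) (t + y) - pU (s + x) t) - (pU s (t + y) - pU s t)
  - ((pV (t + y) (s + x) - pV (t + y) s) - (pV t (s + x) - pV t s)).
rewrite -/(Phi s0 t0 a b); apply: quadrisection => //.
  by move=> s t x y; rewrite /Phi !addrA; ring.
move=> s t e ss tt e0; have [c Hc] := dH s t.
have e40 : 0 < e / 4 by rewrite divr_gt0.
have [d d0 Hd] := Hc _ e40; exists d => // s' t' x y s's t't.
move=> /andP[x0 xd] /andP[y0 yd] /andP[s1 s2] /andP[t1 t2].
(* the affine part of H contributes nothing to Phi, by the Cauchy-Riemann
   equations, and the remainder at most e / 4 (x + y) at each point of a side *)
have approx u v : s' <= u <= s' + x -> t' <= v <= t' + y ->
    `|U u v - U s t - (ReC c * (u - s) - ImC c * (v - t))| <= e / 4 * (x + y) /\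
    `|V u v - V s t - (ImC c * (u - s) + ReC c * (v - t))| <= e / 4 * (x + y).
  move=> /andP[u1 u2] /andP[v1 v2].
  have ux : `|u - s| <= x by rewrite ler_norml; apply/andP; split; lra.
  have vy : `|v - t| <= y by rewrite ler_norml; apply/andP; split; lra.
  have := Hd _ _ (le_lt_trans ux xd) (le_lt_trans vy yd); rewrite !subrKC.
  move=> h; have {}h := le_trans h (ler_wpM2l (ltW e40) (lerD ux vy)).
  split.
    apply: le_trans (le_trans (@Re_le_normc R _) h).
    by rewrite !ReB; case: (c) => ? ? /=.
  apply: le_trans (le_trans (@Im_le_normc R _) h).
  rewrite !ImB; case: (c) => p q /=.
  by rewrite [p * _ + _]addrC.
have sx : s' <= s' + x by rewrite lerDl ltW.
have ty : t' <= t' + y by rewrite lerDl ltW.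
have hs1 : s' <= s' <= s' + x by rewrite lexx.
have hs2 : s' <= s' + x <= s' + x by rewrite lexx sx.
have ht1 : t' <= t' <= t' + y by rewrite lexx.
have ht2 : t' <= t' + y <= t' + y by rewrite lexx ty.
have IU : `|(pU (s' + x) (t' + y) - pU s' (t' + y))
    - (pU (s' + x) t' - pU s' t') - (ReC c * x) * (t' + y - t')|
    <= (e / 2 * (x + y)) * (t' + y - t').
  apply: (@increment_le _ (fun v => pU (s' + x) v - pU s' v)
    (fun v => U (s' + x) v - U s' v)) => // v hv.
    have t0v : t0 - 1 < v by move/andP: hv => [hv _]; lra.
    by apply: is_deriveB; apply: is_derive_prim => //; exact: contU.
  have [+ _] := approx _ _ hs1 hv; have [+ _] := approx _ _ hs2 hv.
  set A := `|_|; set B := `|_| => hA hB.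
  have -> : U (s' + x) v - U s' v - ReC c * x =
     (U (s' + x) v - U s t - (ReC c * (s' + x - s) - ImC c * (v - t))) -
     (U s' v - U s t - (ReC c * (s' - s) - ImC c * (v - t))) by ring.
  by apply: le_trans (ler_normB _ _) _; rewrite -/A -/B; lra.
have IV : `|(pV (t' + y) (s' + x) - pV t' (s' + x))
    - (pV (t' + y) s' - pV t' s') - (ReC c * y) * (s' + x - s')|
    <= (e / 2 * (x + y)) * (s' + x - s').
  apply: (@increment_le _ (fun v => pV (t' + y) v - pV t' v)
    (fun v => V v (t' + y) - V v t')) => // v hv.
    have s0v : s0 - 1 < v by move/andP: hv => [hv _]; lra.
    by apply: is_deriveB; apply: is_derive_prim => //; exact: contV.
  have [_ +] := approx _ _ hv ht1; have [_ +] := approx _ _ hv ht2.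
  set A := `|_|; set B := `|_| => hA hB.
  have -> : V v (t' + y) - V v t' - ReC c * y =
     (V v (t' + y) - V s t - (ImC c * (v - s) + ReC c * (t' + y - t))) -
     (V v t' - V s t - (ImC c * (v - s) + ReC c * (t' - t))) by ring.
  by apply: le_trans (ler_normB _ _) _; rewrite -/A -/B; lra.
move: IU IV; rewrite !(addrC _ y) !(addrC _ x) !addrK => IU IV.
have -> : Phi s' t' x y =
  ((pU (x + s') (y + t') - pU s' (y + t')) - (pU (x + s') t' - pU s' t')
    - ReC c * x * y) -
  ((pV (y + t') (x + s') - pV t' (x + s')) - (pV (y + t') s' - pV t' s')
    - ReC c * y * x).
  by rewrite /Phi (addrC s') (addrC t'); ring.
apply: le_trans (ler_normB _ _) _; apply: le_trans (lerD IU IV) _.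
apply: (@le_trans _ _ (e / 2 * (x + y) ^+ 2)); last rewrite ler_wpM2r ?sqr_ge0//.
  by rewrite le_eqVlt; apply/orP; left; apply/eqP; ring.
by rewrite ler_pdivrMr// ler_peMr ?ltW// ltr1n.
Qed.

(** Periodicity cancels the sides t = 0 and t = p in Cauchy's theorem, so the
    mean of Re H (s, .) over a period does not depend on s; each mean is
    attained. *)
Lemma periodic_real_part_value (s0 s1 p : R) : s0 < s1 -> 0 < p ->
  (forall s, H s p = H s 0) ->
  exists t t', [/\ 0 <= t <= p, 0 <= t' <= p & ReC (H s1 t) = ReC (H s0 t')].
Proof.
move=> s01 p0 per; have a0 : 0 < s1 - s0 by rewrite subr_gt0.
have := @goursat_rectangle s0 0 _ _ a0 p0.
have perV : (fun s => ImC (H s (0 + p))) = (fun s => ImC (H s 0)).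
  by apply/funext => s; rewrite add0r per.
rewrite /= perV !add0r subrKC.
rewrite subrr => /eqP; rewrite subr_eq0 => /eqP PE.
have mvt s : exists2 t, 0 <= t <= p &
    prim (- 1) (U s) p - prim (- 1) (U s) 0 = U s t * p.
  have dP t : 0 <= t <= p -> is_derive t 1 (prim (- 1) (U s)) (U s t).
    move=> /andP[t0 _]; apply: is_derive_prim; [exact: contU|].
    by apply: lt_le_trans t0; rewrite ltrN10.
  have [||t /[!in_itv]/= tp E] :=
    @MVT_segment R (prim (- 1) (U s)) (U s) 0 p (ltW p0).
  - by move=> t /[!in_itv]/= /andP[t0 tp]; apply: dP; rewrite !ltW.
  - apply: derivable_within_continuous => t /[!in_itv]/= txy.
    by have [] := dP _ txy.
  by exists t => //; rewrite E subr0.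
have [t tp Et] := mvt s1; have [t' t'p Et'] := mvt s0.
exists t, t'; split => //.
by apply: (@mulIf _ p); rewrite ?gt_eqF//= -Et -Et'.
Qed.

End Goursat.

Section MaximumPrinciple.
Variable R : realType.
Implicit Types z w : R[i].

(** The first-order expansion with real error bounds, the form that composes
    directly with polar coordinates. *)
Definition cdifferentiable (g : R[i] -> R[i]) : Prop :=
  forall z, exists c : R[i], forall e : R, 0 < e -> exists2 d : R, 0 < d &
    forall w, normc w < d -> normc (g (z + w) - g z - c * w) <= e * normc w.

Lemma is_derive_approx (f : R -> R) (x l : R) : is_derive x 1 f l ->
  forall e : R, 0 < e -> exists2 d : R, 0 < d &
    forall h : R, `|h| < d -> `|f (x + h) - f x - l * h| <= e * `|h|.
Proof.
move=> [df fl] e e0.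
have /cvgrPdist_le/(_ _ e0) [d /= d0 Hd] :
    h^-1 *: ((f \o shift x) (h *: (1 : R)) - f x) @[h --> 0^'] --> l.
  by rewrite -fl; exact: df.
exists d => // h hd; have [->|h0] := eqVneq h 0.
  by rewrite addr0 mulr0 subrr subr0 normr0 mulr0.
have := Hd h; rewrite /= sub0r normrN => /(_ hd h0).
rewrite [h *: 1]mulr1 [h + x]addrC => H.
have -> : f (x + h) - f x - l * h = (h^-1 *: (f (x + h) - f x) - l) * h.
  by rewrite mulrBl mulrAC mulVf// mul1r.
by rewrite normrM ler_wpM2r// distrC.
Qed.

Definition cis (t : R) : R[i] := Complex (cos t) (sin t).

Lemma cisD s t : cis (s + t) = cis s * cis t.
Proof.
rewrite /cis cosD sinD; apply/eqP; rewrite eq_complex /=.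
by apply/andP; split; apply/eqP; ring.
Qed.

(** The exponential of s + i t. *)
Definition polar (s t : R) : R[i] := Complex (expR s * cos t) (expR s * sin t).

Lemma polarD s t x y : polar (s + x) (t + y) = polar s t * polar x y.
Proof.
rewrite /polar expRD cosD sinD; apply/eqP; rewrite eq_complex /=.
by apply/andP; split; apply/eqP; ring.
Qed.

(** The exponential is complex differentiable at 0; by [polarD] this settles
    every other point. *)
Lemma polar_approx (e : R) : 0 < e -> exists2 d : R, 0 < d &
  forall x y : R, `|x| < d -> `|y| < d ->
    normc (polar x y - 1 - Complex x y) <= e * (`|x| + `|y|).
Proof.
(* the error terms below add up to at most 7 h (|x| + |y|) *)
move=> e0; pose h := Num.min (e / 7) 1.
have h0 : 0 < h by rewrite lt_min ltr01 divr_gt0.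
have h1 : h <= 1 by rewrite ge_min lexx orbT.
have h7 : 7 * h <= e.
  have : h <= e / 7 by rewrite ge_min lexx.
  lra.
clearbody h.
have [d1 d10 H1] := is_derive_approx (is_derive_expR (0 : R)) h0.
have [d2 d20 H2] := is_derive_approx (is_derive_cos (0 : R)) h0.
have [d3 d30 H3] := is_derive_approx (is_derive_sin (0 : R)) h0.
exists (Num.min (Num.min d1 d2) (Num.min d3 h)).
  by rewrite !lt_min d10 d20 d30 h0.
move=> x y; rewrite !lt_min => /andP[/andP[x1 _] /andP[_ xh]].
move=> /andP[/andP[_ y2] /andP[y3 yh]].
have {H1} := H1 _ x1; have {H2} := H2 _ y2; have {H3} := H3 _ y3.
rewrite !add0r expR0 cos0 sin0 oppr0 mul0r !subr0 !mul1r ?addr0 => S3 S2 S1.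
apply: le_trans (normc_le_ReIm _) _.
rewrite /polar /= !oppr0 !addr0.
have -> : expR x * cos y - 1 - x =
  (expR x - 1 - x) * cos y + (1 + x) * (cos y - 1) by ring.
have -> : expR x * sin y - y =
  (expR x - 1 - x) * sin y + x * sin y + (sin y - y) by ring.
have cy : `|cos y| <= 1 by rewrite ler_norml cos_geN1 cos_le1.
have sy : `|sin y| <= 1 by rewrite ler_norml sin_geN1 sin_le1.
have x0 := normr_ge0 x; have y0 := normr_ge0 y.
have A1 : `|(expR x - 1 - x) * cos y| <= h * `|x|.
  by rewrite normrM; apply: le_trans S1; rewrite ler_piMr.
have A2 : `|(1 + x) * (cos y - 1)| <= 2 * (h * `|y|).
  rewrite normrM ler_pM//; apply: le_trans (ler_normD _ _) _.
  by rewrite normr1; lra.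
have A3 : `|(expR x - 1 - x) * sin y| <= h * `|x|.
  by rewrite normrM; apply: le_trans S1; rewrite ler_piMr.
have A4 : `|x * sin y| <= 2 * (h * `|y|).
  have : `|sin y| <= 2 * `|y|.
    have -> : sin y = (sin y - y) + y by rewrite subrK.
    apply: le_trans (ler_normD _ _) _.
    have : h * `|y| <= `|y| by rewrite ler_piMl.
    lra.
  move=> H; rewrite normrM mulrCA ler_pM//; exact: ltW.
have N1 := ler_normD ((expR x - 1 - x) * cos y) ((1 + x) * (cos y - 1)).
have N2 := ler_normD ((expR x - 1 - x) * sin y + x * sin y) (sin y - y).
have N3 := ler_normD ((expR x - 1 - x) * sin y) (x * sin y).
have E1 : 7 * h * `|x| <= e * `|x| by rewrite ler_wpM2r.
have E2 : 7 * h * `|y| <= e * `|y| by rewrite ler_wpM2r.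
have P1 : 0 <= h * `|x| by rewrite mulr_ge0// ltW.
have P2 : 0 <= h * `|y| by rewrite mulr_ge0// ltW.
lra.
Qed.

Lemma cr_differentiable_polar g : cdifferentiable g ->
  cr_differentiable (fun s t => g (polar s t)).
Proof.
move=> dg s t; have [c Hc] := dg (polar s t).
set z := polar s t in Hc *; exists (c * z) => e e0.
have nz := @normc_ge0 R z; have nc := @normc_ge0 R (c * z).
pose e1 := e / (2 * (3 * normc z + 1)).
pose e2 := Num.min 1 (e / (2 * (normc (c * z) + 1))).
have e10 : 0 < e1 by rewrite divr_gt0//; lra.
have e20 : 0 < e2 by rewrite lt_min ltr01 divr_gt0//; lra.
have [d1 d10 H1] := Hc _ e10; have [d2 d20 H2] := polar_approx e20.
have d30 : 0 < d1 / (2 * (3 * normc z + 1)) by rewrite divr_gt0//; lra.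
exists (Num.min d2 (d1 / (2 * (3 * normc z + 1)))); first by rewrite lt_min d20.
move=> x y; rewrite !lt_min => /andP[x2 x3] /andP[y2 y3].
have {H2} := H2 _ _ x2 y2; set E := polar x y => HE.
have x0 := normr_ge0 x; have y0 := normr_ge0 y.
have hxy : normc (Complex x y) <= `|x| + `|y| := @normc_le_ReIm R (Complex x y).
have e21 : e2 <= 1 by rewrite ge_min lexx.
have nE : normc (E - 1) <= 3 * (`|x| + `|y|).
  have -> : E - 1 = (E - 1 - Complex x y) + Complex x y by rewrite subrK.
  apply: le_trans (le_normcD _ _) _.
  have : e2 * (`|x| + `|y|) <= `|x| + `|y| by rewrite ler_piMl// addr_ge0.
  lra.
have zE : polar (s + x) (t + y) = z + z * (E - 1).
  by rewrite polarD -/z -/E; ring.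
have nw : normc (z * (E - 1)) <= (3 * normc z + 1) * (`|x| + `|y|).
  rewrite normcM; apply: (@le_trans _ _ (normc z * (3 * (`|x| + `|y|)))).
    by rewrite ler_wpM2l.
  lra.
have wd : normc (z * (E - 1)) < d1.
  apply: le_lt_trans nw _; rewrite mulrC -ltr_pdivlMr; last lra.
  have -> : d1 / (3 * normc z + 1) = d1 / (2 * (3 * normc z + 1)) +
      d1 / (2 * (3 * normc z + 1)).
    by field; apply/lt0r_neq0; lra.
  exact: ltrD.
rewrite zE.
have -> : g (z + z * (E - 1)) - g z - c * z * Complex x y =
  (g (z + z * (E - 1)) - g z - c * (z * (E - 1))) +
  (c * z) * (E - 1 - Complex x y) by ring.
apply: le_trans (le_normcD _ _) _; rewrite (normcM (c * z)).
have B1 := H1 _ wd.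
have B2 : e1 * normc (z * (E - 1)) <= e / 2 * (`|x| + `|y|).
  apply: le_trans (ler_wpM2l (ltW e10) nw) _.
  rewrite le_eqVlt; apply/orP; left; apply/eqP; rewrite /e1.
  by field; apply/lt0r_neq0; lra.
have B3 : normc (c * z) * normc (E - 1 - Complex x y) <= e / 2 * (`|x| + `|y|).
  apply: le_trans (ler_wpM2l nc HE) _; rewrite mulrA ler_wpM2r ?addr_ge0//.
  have : e2 <= e / (2 * (normc (c * z) + 1)) by rewrite ge_min lexx orbT.
  move=> h; apply: le_trans (ler_wpM2l nc h) _.
  have -> : normc (c * z) * (e / (2 * (normc (c * z) + 1))) =
     e / 2 * (normc (c * z) / (normc (c * z) + 1)).
    by field; apply/lt0r_neq0; lra.
  rewrite ler_piMr//; first by lra.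
  by rewrite ler_pdivrMr; lra.
lra.
Qed.

(** After a rotation, g 0 > 0.  By [periodic_real_part_value] some value of Re g
    on the unit circle equals one on a circle so small that Re g exceeds q g 0
    there by continuity. *)
Lemma maximum_principle g (q : R) : cdifferentiable g -> 0 < q -> q < 1 ->
  exists2 t : R, 0 <= t <= 2 * pi &
    q * normc (g 0) <= normc (g (cis t)).
Proof.
move=> dg q0 q1; have [g0|g0] := eqVneq (normc (g 0)) 0.
  exists 0; first by rewrite lexx mulr_ge0// pi_ge0.
  by rewrite g0 mulr0 (@normc_ge0 R).
have {}g0 : 0 < normc (g 0) by rewrite lt_neqAle eq_sym g0 (@normc_ge0 R).
(* rotate g so that its value at the centre is a positive real *)
pose u : R[i] := conjc (g 0) / (normc (g 0))%:C%C.
have nu : normc u = 1.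
  rewrite normcM normcV normcR ger0_norm ?ltW//.
  rewrite (_ : normc (conjc (g 0)) = normc (g 0)) ?divff ?gt_eqF//.
  by case: (g 0) => a b /=; rewrite sqrrN.
have ug0 : complex.Re (u * g 0) = normc (g 0).
  have n2 : complex.Re (conjc (g 0) * g 0) = normc (g 0) ^+ 2.
    case: (g 0) => a b /=; rewrite sqr_sqrtr ?addr_ge0 ?sqr_ge0//; ring.
  rewrite /u mulrAC -fmorphV mulrC.
  case: (conjc (g 0) * g 0) n2 => a b /= ->.
  by rewrite mul0r subr0 expr2 mulKf// gt_eqF.
pose h z := u * g z.
have dh : cdifferentiable h.
  move=> z; have [c Hc] := dg z; exists (u * c) => e /Hc[d d0 Hd].
  exists d => // w /Hd; apply: le_trans.
  rewrite /h (_ : _ - _ - _ = u * (g (z + w) - g z - c * w)); last by ring.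
  by rewrite normcM nu mul1r.
have [c /(_ 1 ltr01)[d d0 Hd]] := dh 0.
have nc := @normc_ge0 R c.
(* inside the unit disc, and small enough for the first-order expansion at 0 to
   keep Re h above q |g 0| *)
pose r := Num.min (Num.min (d / 2) (1 / 2)) ((1 - q) * normc (g 0) / (normc c + 1)).
have rpos : 0 < r.
  rewrite !lt_min divr_gt0//= divr_gt0//= divr_gt0//; last by lra.
  by rewrite mulr_gt0// subr_gt0.
have rd : r < d.
  apply: (@le_lt_trans _ _ (d / 2)); first by rewrite !ge_min lexx.
  lra.
have r1 : r < 1.
  apply: (@le_lt_trans _ _ (1 / 2)); first by rewrite !ge_min lexx orbT.
  lra.
have near0 z : normc z = r -> q * normc (g 0) <= complex.Re (h z).
  move=> zr; have := Hd z; rewrite zr add0r mul1r => /(_ rd) hz.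
  have h1 : normc (h z - h 0) <= (normc c + 1) * r.
    have -> : h z - h 0 = (h z - h 0 - c * z) + c * z by rewrite subrK.
    by apply: le_trans (le_normcD _ _) _; rewrite normcM zr; lra.
  have h2 : (normc c + 1) * r <= (1 - q) * normc (g 0).
    rewrite mulrC -ler_pdivlMr; last by lra.
    by rewrite ge_min lexx orbT.
  have := le_trans (@Re_le_normc R _) (le_trans h1 h2).
  rewrite (_ : complex.Re (h z - h 0) = complex.Re (h z) - normc (g 0)); last first.
    by rewrite -ug0 -/(h 0); case: (h z) (h 0) => ? ? [].
  rewrite ler_norml => /andP[]; lra.
have s00 : ln r < 0 by rewrite ln_lt0// rpos.
have per s : h (polar s (2 * pi)) = h (polar s 0).
  by rewrite /polar mulr_natl cos2pi sin2pi cos0 sin0.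
have pi2 : 0 < 2 * pi :> R by rewrite mulr_gt0// pi_gt0.
have [t [t' [tp _ E]]] :=
  periodic_real_part_value (cr_differentiable_polar dh) s00 pi2 per.
exists t => //; apply: (@le_trans _ _ (complex.Re (h (polar 0 t)))).
  rewrite E; apply: near0; rewrite /polar lnK//.
  rewrite /= !exprMn -mulrDr cos2Dsin2 mulr1 sqrtr_sqr ger0_norm// ltW//.
apply: le_trans (ler_norm _) _; apply: le_trans (@Re_le_normc R _) _.
by rewrite /h normcM nu mul1r /polar expR0 !mul1r.
Qed.

End MaximumPrinciple.

(** * A discrete form of Jensen's inequality *)

Section DiscreteJensen.
Variables (R : realType) (k : nat).
Local Notation C := (Cfield R).
Local Notation V := (Cvec R k).

Lemma derivable_cdifferentiable (g : C -> C) :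
  (forall z, derivable (g : C -> C^o) z 1) -> cdifferentiable g.
Proof.
move=> dg z; pose c : C := 'D_1 (g : C -> C^o) z.
exists c => e e0.
have H : h^-1 *: ((g \o shift z) (h *: (1 : C)) - g z) @[h --> 0^'] --> (c : C^o).
  exact: dg.
have ec0 : 0 < (e%:C)%C :> C by rewrite (ltcR 0).
move/cvgrPdist_le : H => /(_ _ ec0).
move=> /(@near_normcP R 0)[d d0 Hd]; exists d => // w wd.
have [->|w0] := eqVneq w 0; first by rewrite addr0 mulr0 subrr subr0 normc0 mulr0.
have := Hd w; rewrite subr0 => /(_ wd w0) /=.
rewrite [w *: 1]mulr1 [w + z]addrC normE (lecR _ e) => H.
have -> : g (z + w) - g z - c * w = (w^-1 *: (g (z + w) - g z) - c) * w.
  by rewrite mulrBl /GRing.scale/= mulrAC mulVf// mul1r.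
by rewrite normcM ler_wpM2r ?(@normc_ge0 R)// normcB.
Qed.

Lemma derivable_mul (f g : C -> C) (z : C) :
  derivable (f : C -> C^o) z 1 -> derivable (g : C -> C^o) z 1 ->
  derivable ((fun z => f z * g z) : C -> C^o) z 1.
Proof.
by move=> df dg; have := derivableM df dg;
  rewrite (_ : (fun z => f z * g z) = (f : C -> C^o) * (g : C -> C^o)).
Qed.

Lemma derivable_add (f g : C -> C) (z : C) :
  derivable (f : C -> C^o) z 1 -> derivable (g : C -> C^o) z 1 ->
  derivable ((fun z => f z + g z) : C -> C^o) z 1.
Proof.
by move=> df dg; have := derivableD df dg;
  rewrite (_ : (fun z => f z + g z) = (f : C -> C^o) + (g : C -> C^o)).
Qed.

Lemma derivable_prod (I : Type) (r : seq I) (h : I -> C -> C) (z : C) :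
  (forall i, derivable (h i : C -> C^o) z 1) ->
  derivable ((fun z => \prod_(i <- r) h i z) : C -> C^o) z 1.
Proof.
move=> dh; elim: r => [|i r IH].
  by under eq_fun do rewrite big_nil; exact: derivable_cst.
by under eq_fun do rewrite big_cons; exact: derivable_mul (dh i) IH.
Qed.

Lemma derivable_bigsum (I : Type) (r : seq I) (h : I -> C -> C) (z : C) :
  (forall i, derivable (h i : C -> C^o) z 1) ->
  derivable ((fun z => \sum_(i <- r) h i z) : C -> C^o) z 1.
Proof.
move=> dh; elim: r => [|i r IH].
  by under eq_fun do rewrite big_nil; exact: derivable_cst.
by under eq_fun do rewrite big_cons; exact: derivable_add (dh i) IH.
Qed.

(** A substitute for Jensen's inequality: averaging over N-th roots of unity is
    done inside the modulus, by multiplying N rotated copies of a holomorphic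
    function.  Pairing with the vector f 0 reduces to scalar functions without
    loss at the centre. *)
Lemma discrete_jensen (f : C -> V) (N : nat) (q : R) :
  (forall z, differentiable f z) -> f 0 != 0 -> 0 < q -> q < 1 ->
  exists2 t : R, 0 <= t <= 2 * pi &
    q * eucl_norm (f 0) ^+ N <=
    \prod_(j < N) eucl_norm (f (cis (t + 2 * pi / N%:R * j%:R))).
Proof.
move=> df f0 q0 q1; pose w (j : nat) : C := cis (2 * pi / N%:R * j%:R).
pose h (j : nat) (z : C) : C := hdot (f 0) (f (w j * z)).
pose g (z : C) : C := \prod_(j < N) h j z.
have dg : cdifferentiable g.
  apply: derivable_cdifferentiable => z; apply: derivable_prod => j.
  apply: derivable_bigsum => i; apply: derivable_mul; first exact: derivable_cst.
  apply/derivable1_diffP.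
  apply: (@differentiable_comp _ _ _ _ (fun z : C => f (w j * z)) (fun x : V => x 0 i : C^o)).
    apply: (@differentiable_comp _ _ _ _ (fun z : C => (w j * z : C^o)) f).
      exact: (differentiableZ (w j)).
    exact: df.
  exact: differentiable_coord.
have [t tp tg] := maximum_principle dg q0 q1; exists t => //.
have nf0 : 0 < eucl_norm (f 0) by rewrite eucl_norm_gt0.
have nfN : 0 < eucl_norm (f 0) ^+ N by rewrite exprn_gt0.
rewrite -(ler_pM2l nfN) mulrCA -expr2 exprAC.
have -> : (eucl_norm (f 0) ^+ 2) ^+ N = normc (g 0).
  rewrite /g normc_prod (eq_bigr (fun=> eucl_norm (f 0) ^+ 2)).
    by rewrite prodr_const card_ord.
  by move=> j _; rewrite /h mulr0 hdot_self.
apply: le_trans tg _; rewrite /g normc_prod.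
have -> : eucl_norm (f 0) ^+ N = \prod_(j < N) eucl_norm (f 0).
  by rewrite prodr_const card_ord.
rewrite -big_split/=; apply: ler_prod => j _; rewrite (@normc_ge0 R)/=.
by rewrite /h addrC cisD; exact: cauchy_schwarz_hdot.
Qed.

End DiscreteJensen.

(** * From Riemann sums to means over the circle *)

Section CircleMean.
Variable R : realType.
Implicit Types (v : R -> R) (c e : R).
Local Notation mu := (@lebesgue_measure R).

Lemma heine_segment v (a b e : R) : continuous v -> 0 < e ->
  exists2 d : R, 0 < d & forall x y : R, a <= x <= b -> `|x - y| < d ->
    `|v x - v y| < e.
Proof.
move=> cv e0.
have /compact_near_coveringP cov := @segment_compact R a b.
have := cov R (0 : R)^'+ (fun d x => forall y : R, `|x - y| < d -> `|v x - v y| < e) _.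
case=> [x _|d /= d0 Hd].
  have e20 : 0 < e / 2 by rewrite divr_gt0.
  have /cvgrPdist_lt/(_ _ e20)/nbhs_normP[d /= d0 Hd] := cv x.
  have d20 : 0 < d / 2 by rewrite divr_gt0.
  have nx : nbhs x (ball x (d / 2)) by exact: nbhsx_ballx.
  have nd : \forall h \near (0 : R)^'+, h < d / 2 by exact: nbhs_right_lt.
  exists (ball x (d / 2), [set h | h < d / 2]) => //.
  move=> [x' h] [/= xx' hd] y x'y.
  move: xx'; rewrite -ball_normE /ball_ /= => xx'.
  have h1 : `|v x - v x'| < e / 2 by apply: Hd => /=; lra.
  have h2 : `|v x - v y| < e / 2.
    apply: Hd => /=; have -> : x - y = (x - x') + (x' - y) by ring.
    apply: le_lt_trans (ler_normD _ _) _; lra.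
  have -> : v x' - v y = (v x - v y) - (v x - v x') by ring.
  by apply: le_lt_trans (ler_normB _ _) _; lra.
exists (d / 2); first by rewrite divr_gt0.
move=> x y xab xy; apply: (Hd (d / 2)) => //=.
  by rewrite sub0r normrN ger0_norm ?divr_ge0 ?ltW//; lra.
by rewrite divr_gt0.
Qed.

Lemma integral_prim v (a b c : R) : continuous v -> c < a -> a < b ->
  (\int[mu]_(t in `[a, b]) (v t)%:E = (prim c v b - prim c v a)%:E)%E.
Proof.
move=> cv ca ab.
have dP x : a <= x -> is_derive x 1 (prim c v) (v x).
  by move=> ax; apply: is_derive_prim => //; exact: lt_le_trans ax.
have contP x : a <= x -> {for x, continuous (prim c v)}.
  move=> /dP[dx _]; apply: differentiable_continuous.
  exact/derivable1_diffP.
rewrite EFinB; apply: continuous_FTC2 => //.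
- exact: continuous_subspaceT.
- split.
  + by move=> x /[!in_itv]/= /andP[/ltW/dP[]].
  + by apply: cvg_at_right_filter; exact: contP.
  + by apply: cvg_at_left_filter; apply: contP; exact: ltW.
- move=> x /[!in_itv]/= /andP[/ltW/dP[_ <-] _].
  by rewrite derive1E.
Qed.

(** By uniform continuity the N-point sums of [v] approximate its mean whatever
    the starting angle t, which is why t is allowed to depend on N and e. *)
Lemma riemann_mean_le_integral v c : continuous v ->
  (forall t, v (t + 2 * pi) = v t) ->
  (forall (N : nat) e, (0 < N)%N -> 0 < e -> exists2 t : R, 0 <= t <= 2 * pi &
     c <= N%:R^-1 * \sum_(j < N) v (t + 2 * pi / N%:R * j%:R) + e) ->
  ((c * (2 * pi))%:E <= \int[mu]_(t in `[0%R, (2 * pi)%R]) (v t)%:E)%E.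
Proof.
move=> cv per mean; have p0 : 0 < 2 * pi :> R by rewrite mulr_gt0// pi_gt0.
set p := 2 * pi in per mean p0 *.
rewrite (@integral_prim v 0 p (- 1))//.
rewrite lee_fin; set P := prim (-1) v.
have dP (x : R) : 0 <= x -> is_derive x 1 P (v x).
  by move=> x0; apply: is_derive_prim => //; apply: lt_le_trans x0; rewrite ltrN10.
have shift (t : R) : 0 <= t -> P (t + p) - P t = P p - P 0.
  move=> t0; have := @increment_le R (fun x => P (x + p) - P x)
    (fun x => v (x + p) - v x) 0 t 0 0 t0.
  rewrite add0r !mul0r subr0 normr_le0 subr_eq0 => H; apply/eqP; apply: H.
    move=> x /andP[x0 _]; apply: is_deriveB; last exact: dP.
    have xp0 : 0 <= x + p by rewrite addr_ge0// ltW.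
    have d1 : is_derive (shift p x) 1 P (v (x + p)) by exact: dP.
    by have := is_derive1_comp d1 (is_derive_shift x 1 p); rewrite mulr1.
  by move=> x _; rewrite per !subrr normr0.
apply/ler_addgt0Pr => e e0.
have e20 : 0 < e / (2 * p) by rewrite divr_gt0// mulr_gt0.
have [d d0 Hd] := heine_segment 0 (p + p) cv e20.
pose N := (Num.truncn (p / d)).+1.
have N0 : 0 < N%:R :> R by rewrite ltr0n.
have Nd : p / N%:R < d.
  rewrite ltr_pdivrMr// mulrC -ltr_pdivrMr//.
  exact: truncnS_gt.
have [t /andP[t0 tp] tc] := mean N _ isT e20.
set h := p / N%:R in tc Nd.
have h0 : 0 < h by rewrite divr_gt0.
have NhE : N%:R * h = p by rewrite mulrC divfK// gt_eqF.
have tele : P (t + p) - P t =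
    \sum_(j < N) (P (t + h * j.+1%:R) - P (t + h * j%:R)).
  have := @telescope_sumr R 0 N (fun j => P (t + h * j%:R)) (leq0n N).
  by rewrite big_mkord mulr0 addr0 [h * N%:R]mulrC NhE.
have lower (j : 'I_N) : (v (t + h * j%:R) - e / (2 * p)) * h <=
    P (t + h * j.+1%:R) - P (t + h * j%:R).
  have jh0 : 0 <= h * j%:R by rewrite mulr_ge0// ltW.
  have jhp : h * j%:R + h <= p.
    rewrite -NhE mulrC -[X in _ + X <= _]mul1r -mulrDl natr1.
    by rewrite ler_wpM2r ?ler_nat// ltW.
  have nE : t + h * j.+1%:R = (t + h * j%:R) + h by rewrite -natr1; ring.
  rewrite nE; set x := t + h * j%:R.
  have x0 : 0 <= x by rewrite addr_ge0.
  have xh : x <= x + h by rewrite lerDl ltW.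
  (* the nodes lie in [0, 2 p], the segment of uniform continuity *)
  have := @increment_le R P v x (x + h) (v x) (e / (2 * p)) xh.
  rewrite (_ : x + h - x = h); last by rewrite addrC addKr.
  move=> H; suff : `|P (x + h) - P x - v x * h| <= e / (2 * p) * h.
    by rewrite ler_norml => /andP[+ _]; lra.
  apply: H => u /andP[xu uxh]; first by apply: dP; exact: le_trans xu.
  have xp : 0 <= x <= p + p by rewrite x0 /x lerD//; lra.
  rewrite distrC ltW// Hd//; apply: le_lt_trans Nd.
  by rewrite distrC ger0_norm ?subr_ge0//; lra.
rewrite -(shift t t0) tele.
apply: (@le_trans _ _ (\sum_(j < N) (v (t + h * j%:R) - e / (2 * p)) * h + e)); last first.
  by rewrite lerD2r ler_sum// => j _; exact: lower.
rewrite -mulr_suml big_split/= sumr_const card_ord -[_ *+ N]mulr_natl.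
set S := \sum_(_ < _) _ in tc *.
have -> : (S + N%:R * - (e / (2 * p))) * h = N%:R^-1 * S * p - e / 2.
  by rewrite /h; field; rewrite !gt_eqF.
have := ler_wpM2r (ltW p0) tc.
have -> : (N%:R^-1 * S + e / (2 * p)) * p = N%:R^-1 * S * p + e / 2.
  by field; rewrite !gt_eqF.
lra.
Qed.

Definition trunc (K : R) (x : \bar R) : R := fine (maxe x (- K)%:E).

Lemma trunc_continuous (T : topologicalType) (u : T -> \bar R)
    (K : R) : continuous u -> (forall t, (u t < +oo)%E) ->
  continuous (fun t => trunc K (u t)).
Proof.
move=> cu uy t; have := cu t; rewrite /continuous_at.
have truncE (r : R) : trunc K r%:E = Num.max r (- K) by rewrite /trunc -EFin_max.
have := uy t; case: (u t) => [r _|//|_].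
  move=> /fine_cvgP[ufin ur]; apply/cvgrPdist_lt => e e0.
  have key (q : R) : `|r - q| < e -> `|Num.max r (- K) - Num.max q (- K)| < e.
    rewrite !maxr_absE !ltr_norml => /andP[h1 h2].
    by case: (ler0P (r - - K)); case: (ler0P (q - - K)) => h3 h4;
      apply/andP; split; lra.
  have ur' : \forall s \near t, `|r - fine (u s)| < e.
    by move/cvgrPdist_lt : ur; apply.
  apply: filterS2 ufin ur' => s us /key.
  by rewrite truncE -{2}(fineK us) truncE.
move=> /cvgeNyPle/(_ (- K)) h.
have -> : trunc K -oo = - K.
  by rewrite /trunc (_ : maxe -oo%E (- K)%:E = (- K)%:E)//; apply/max_idPr; exact: leNye.
apply: cvg_near_cst; apply: filterS h => s us.
by rewrite /trunc (_ : maxe _ _ = (- K)%:E)//; apply/max_idPr.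
Qed.

(** Monotone convergence for B - max (u, -K), which is nonnegative for B large
    and increases to B - u. *)
Lemma submean_of_truncations (u : R -> \bar R) (c : R) (B : R) :
  (forall t, (u t <= B%:E)%E) ->
  (forall K, continuous (fun t => trunc K (u t))) ->
  (forall t, u (t + 2 * pi) = u t) ->
  (forall (N : nat) e, (0 < N)%N -> 0 < e -> exists2 t : R, 0 <= t <= 2 * pi &
     forall K, c <= N%:R^-1 * \sum_(j < N) trunc K (u (t + 2 * pi / N%:R * j%:R)) + e) ->
  (c%:E <= ((2 * pi)^-1)%:E * \int[mu]_(t in `[0%R, (2 * pi)%R]) u t)%E.
Proof.
move=> uB0 cK per mean; have p0 : 0 < 2 * pi :> R by rewrite mulr_gt0// pi_gt0.
(* a nonnegative bound also dominates the truncations at -n *)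
pose b := Num.max B 0.
have b0 : 0 <= b by rewrite le_max lexx orbT.
have uB t : (u t <= b%:E)%E.
  by apply: le_trans (uB0 t) _; rewrite lee_fin le_max lexx.
set p := 2 * pi in per mean p0 *.
have truncE (n : nat) t : (trunc n%:R (u t))%:E = maxe (u t) (- n%:R)%:E.
  rewrite /trunc fineK// fin_numElt maxEle; case: ifPn => [_|].
    by rewrite ltNyr ltry.
  rewrite -ltNge => nu; rewrite (lt_trans (ltNyr _) nu)/=.
  exact: le_lt_trans (uB t) (ltry _).
pose W n t : \bar R := (b - trunc n%:R (u t))%:E.
have W0 n t : (0 <= W n t)%E.
  rewrite lee_fin subr_ge0 -lee_fin truncE ge_max uB lee_fin.
  by rewrite (le_trans _ b0)// oppr_le0.
have Wnd t : {homo W ^~ t : m n / (m <= n)%N >-> (m <= n)%E}.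
  move=> m n mn; rewrite lee_fin lerD2l lerN2 -lee_fin !truncE.
  by rewrite ge_max le_max lexx/= le_max lee_fin lerN2 ler_nat mn orbT.
have Wcvg t : W n t @[n --> \oo] --> (b%:E - u t)%E.
  have E n : W n t = (b%:E - maxe (u t) (- n%:R)%:E)%E by rewrite /W EFinB truncE.
  under eq_cvg do rewrite E.
  have := uB t; case: (u t) => [r _| //|_].
  - have : \forall n \near \oo, (b%:E - maxe r%:E (- n%:R)%:E = b%:E - r%:E)%E.
      near=> n; rewrite (_ : maxe r%:E (- n%:R)%:E = r%:E)//; apply/max_idPl.
      rewrite lee_fin lerNl; near: n; exact: nbhs_infty_ger.
    exact: cvg_near_cst.
  - rewrite (_ : (b%:E - -oo = +oo)%E)//; apply/cvgeyPge => A; near=> n.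
    rewrite (_ : maxe -oo (- n%:R)%:E = (- n%:R)%:E)%E; last first.
      by apply/max_idPr; exact: leNye.
    rewrite -EFinB opprK lee_fin ler_wpDl//.
    near: n; exact: nbhs_infty_ger.
have mW n : measurable_fun `[0, p] (W n).
  apply/measurable_EFinP; apply: measurable_funTS.
  apply: continuous_measurable_fun => t.
  by apply: cvgB; [exact: cvg_cst|exact: cK].
have mu_p : mu `[0, p] = p%:E.
  by rewrite lebesgue_measure_itv/= lte_fin p0 oppr0 adde0.
have Ib : (\int[mu]_(t in `[0%R, p]) b%:E = (b * p)%:E)%E.
  by transitivity (b%:E * mu `[0%R, p])%E; [exact: integral_cst|rewrite mu_p].
have IW n : (\int[mu]_(t in `[0%R, p]) W n t <= ((b - c) * p)%:E)%E.
  have h : ((c * (2 * pi))%:E <=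
      \int[mu]_(t in `[0%R, (2 * pi)%R]) (trunc n%:R (u t))%:E)%E.
    apply: riemann_mean_le_integral => [|t|N e N0 e0]; first exact: cK.
      by rewrite per.
    by have [t tp H] := mean N e N0 e0; exists t.
  have ib (g : R -> R) : continuous g -> mu.-integrable `[0, p] (EFin \o g).
    move=> cg; apply: continuous_compact_integrable; first exact: segment_compact.
    exact: continuous_subspaceT.
  rewrite /W; under eq_integral do rewrite EFinB.
  rewrite integralB_EFin//; [|exact: (ib (cst b) (@cst_continuous _ _ b))|exact: ib].
  rewrite [X in (X - _)%E]Ib mulrBl EFinB leeB//.
have mlim : measurable_fun `[0, p] (fun t => (b%:E - u t)%E).
  exact: (@emeasurable_fun_cvg _ _ _ _ W).
have Ilim : (\int[mu]_(t in `[0%R, p]) (b%:E - u t) <= ((b - c) * p)%:E)%E.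
  have -> : (\int[mu]_(t in `[0%R, p]) (b%:E - u t) =
      \int[mu]_(t in `[0%R, p]) limn (W ^~ t))%E.
    by apply: eq_integral => t _; apply/esym/cvg_lim.
  rewrite monotone_convergence//.
  apply: lime_le; last exact: nearW IW.
  apply: ereal_nondecreasing_is_cvgn => m n mn.
  by apply: ge0_le_integral => //; [exact: mW|exact: mW|move=> t _; exact: Wnd].
have lim0 t : (0 <= b%:E - u t)%E by rewrite sube_ge0 ?uB// orbT.
have iW : mu.-integrable `[0, p] (fun t => (b%:E - u t)%E).
  apply/integrableP; split=> //; under eq_integral do rewrite gee0_abs//.
  exact: le_lt_trans Ilim (ltry _).
have ib : mu.-integrable `[0, p] (cst b%:E).
  apply: (@continuous_compact_integrable _ (cst b)); first exact: segment_compact.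
  exact/continuous_subspaceT/cst_continuous.
have -> : (\int[mu]_(t in `[0%R, p]) u t = \int[mu]_(t in `[0%R, p]) (cst b%:E \- (fun t => b%:E - u t)) t)%E.
  apply: eq_integral => t _ /=; rewrite oppeB ?fin_num_adde_defr//.
  by rewrite addeA subee// add0e.
rewrite integralB// [X in (X - _)%E]Ib.
have fI : (\int[mu]_(t in `[0%R, p]) (b%:E - u t))%E \is a fin_num.
  exact: integrable_fin_num iW.
rewrite -(fineK fI) in Ilim *; rewrite lee_fin in Ilim.
rewrite -EFinB -EFinM lee_fin mulrC ler_pdivlMr//; lra.
Unshelve. all: by end_near. Qed.

End CircleMean.

(** * The topology of projective space *)

Section ProjectivePoints.
Variables (R : realType) (k : nat).
Local Notation C := (Cfield R).
Local Notation V := (Cvec R k).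
Local Notation P := (projspace R k).
Implicit Types x y : V.

Definition to_nonzero x (x0 : x != 0) : nonzero R k := exist _ x (mem_set x0).

Lemma nonzeroP (x : nonzero R k) : val x != 0.
Proof. exact: set_mem (valP x). Qed.

Lemma proj_eqP (x y : nonzero R k) :
  proj x = proj y <-> exists2 c : C, c != 0 & val x = c *: val y.
Proof.
split=> [/eqquotP|H]; first by move/asboolP.
by apply/eqquotP/asboolP.
Qed.

Lemma const1_neq0 : (const_mx 1 : V) != 0.
Proof. by apply/eqP => /rowP/(_ ord0)/eqP; rewrite !mxE oner_eq0. Qed.

(** The class of a vector, extended to 0 by an arbitrary value in order to be a
    total function. *)
Definition line x : P :=
  match pselect (x != 0) with
  | left x0 => proj (to_nonzero x0)
  | right _ => proj (to_nonzero const1_neq0)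
  end.

Lemma lineE (x : nonzero R k) : line (val x) = proj x.
Proof.
rewrite /line; case: pselect => [x0|]; last by rewrite nonzeroP.
by congr proj; apply: val_inj.
Qed.

Lemma line_to_nonzero x (x0 : x != 0) : line x = proj (to_nonzero x0).
Proof. exact: (lineE (to_nonzero x0)). Qed.

Lemma line_surj (p : P) : exists2 x, x != 0 & line x = p.
Proof.
exists (val (repr p)); first exact: nonzeroP.
by rewrite lineE; exact: reprK.
Qed.

Lemma lineZ (c : C) x : c != 0 -> line (c *: x) = line x.
Proof.
move=> c0; have [->|x0] := eqVneq x 0; first by rewrite scaler0.
have cx0 : c *: x != 0 by rewrite scaler_eq0 negb_or c0.
rewrite (line_to_nonzero x0) (line_to_nonzero cx0).
by apply/proj_eqP; exists c.
Qed.

Lemma line_eqP x y : x != 0 -> y != 0 -> line x = line y ->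
  exists2 c : C, c != 0 & x = c *: y.
Proof.
move=> x0 y0; rewrite (line_to_nonzero x0) (line_to_nonzero y0).
by move/proj_eqP.
Qed.

Lemma nbhs_neq0 x : x != 0 -> \forall y \near x, y != 0.
Proof.
rewrite -eucl_norm_gt0 => x0.
have : \forall y \near x, 0 < eucl_norm y.
  by have := @eucl_norm_continuous R k x; move/cvgr_gt; exact.
by apply: filterS => y; rewrite eucl_norm_gt0.
Qed.

(** The projection is open, since the preimage of [line @` U] is the union of
    the homothetic images of [U]. *)
Lemma nbhs_line x (U : set V) : x != 0 -> nbhs x U ->
  nbhs (line x) (line @` (U `&` [set y | y != 0])).
Proof.
move=> x0 xU; pose B := U°.
have oB : open B by exact: open_interior.
have Bx : B x by [].
have BU : B `<=` U by exact: interior_subset.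
pose B' : set V := B `&` [set y | y != 0].
have oB' : open B'.
  apply: openI => //; rewrite openE => y y0; exact: nbhs_neq0.
rewrite nbhsE; exists (line @` B'); last first.
  by apply: image_subset => y [By y0]; split => //; exact: BU.
split; last by exists x.
have -> : (open (line @` B' : set P)) = open (@proj R k @^-1` (line @` B')) by [].
exists (\bigcup_(c in [set c : C | c != 0]) ((fun y => c *: y) @^-1` B')).
  apply: bigcup_open => c c0; apply: open_comp => // y _.
  exact: scaler_continuous.
apply/seteqP; split => y /=.
  move=> [c /= c0 [Bcy cy0]]; exists (c *: val y) => //.
  by rewrite lineZ// lineE.
move=> [z [Bz z0]]; rewrite -lineE => /line_eqP-/(_ z0 (nonzeroP y))[c c0 zE].
exists c; first exact: c0.
have B'z : B' z by split.
by rewrite zE in B'z.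
Qed.

Lemma line_continuous x : x != 0 -> {for x, continuous line}.
Proof.
move=> x0 A; rewrite (line_to_nonzero x0) => xA; pose B := A°.
have oB : open B by exact: open_interior.
have Bx : B (proj (to_nonzero x0)) by [].
have BA : B `<=` A by exact: interior_subset.
have [D oD DE] : open (@proj R k @^-1` B) by exact: oB.
have : nbhs x D.
  apply: open_nbhs_nbhs; split => //.
  have : (@proj R k @^-1` B) (to_nonzero x0) by [].
  by rewrite -DE.
move=> /(filterI (nbhs_neq0 x0)); apply: filterS => y [y0 Dy].
apply: BA; rewrite (line_to_nonzero y0) -[B _]/((@proj R k @^-1` B) _) -DE.
exact: Dy.
Qed.

(** A product with an identity map of a quotient map need not be a quotient map;
    here it is one, because the projection is open. *)
Lemma continuous_on_projspace (X T : topologicalType) (g : X * P -> T) :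
  (forall l x, x != 0 -> {for (l, x), continuous (fun p : X * V => g (p.1, line p.2))}) ->
  continuous g.
Proof.
move=> cg [l p] A; have [x x0 <-] := line_surj p.
move=> /(cg l x x0)[[U W]/= [lU xW] UWA].
exists (U, line @` (W `&` [set y | y != 0])).
  by split => //=; exact: nbhs_line.
move=> [l' _] /= [Ul' [y [Wy _] <-]].
exact: (UWA (l', y)).
Qed.

(** A closed subset of a product of squares of the complex plane. *)
Lemma compact_sphere : compact [set x : V | eucl_norm x = 1].
Proof.
have cI : compact (`[-1, 1]%classic : set R) by exact: segment_compact.
pose toC (p : R * R) : C := Complex p.1 p.2.
have toC_cont : continuous toC.
  apply: continuous_Complex => p; [exact: cvg_fst|exact: cvg_snd].
have cD : compact (toC @` (`[-1, 1] `*` `[-1, 1])).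
  apply: continuous_compact; last exact: compact_setX.
  exact: continuous_subspaceT.
have := @rV_compact C k.+1 (fun=> toC @` (`[-1, 1] `*` `[-1, 1])) (fun=> cD).
move=> cK; apply: (subclosed_compact _ cK).
  rewrite (_ : [set x | _] = @eucl_norm R k @^-1` [set 1])//.
  by apply: closed_comp => [x _|]; [exact: eucl_norm_continuous|exact: closed_eq].
move=> x /= x1 i; have := normc_le_eucl x i; rewrite x1 => xi.
exists (complex.Re (x 0 i : R[i]), complex.Im (x 0 i : R[i])); last first.
  by rewrite /toC /=; case: (x 0 i).
have := le_trans (@Re_le_normc R _) xi; have := le_trans (@Im_le_normc R _) xi.
by rewrite !ler_norml => ? ?; split => /=; rewrite in_itv.
Qed.

End ProjectivePoints.

(** * A cohomological equation *)

Section CohomologicalEquation.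
Variable R : realType.

Lemma eventually_lt_geometric (d : nat) (c e : R) : (2 <= d)%N -> 0 < e ->
  exists N, forall n, (N <= n)%N -> c / d%:R ^+ n < e.
Proof.
move=> d2 e0.
have h : c * (d%:R^-1) ^+ n @[n --> \oo] --> (0 : R).
  rewrite -(mulr0 c); apply: cvgMr; apply: cvg_expr.
  by rewrite ger0_norm// invf_lt1// ?ltr1n// ltr0n; exact: leq_trans d2.
have [N _ NP] : \forall n \near \oo, c * (d%:R^-1) ^+ n < e.
  exact: cvgr_lt h _ e0.
by exists N => n /NP /=; rewrite exprVn.
Qed.

(** The solution is the sum over n of phi (T^n x) / d^(n+1).  Its partial sums gn
    are built from the equation itself, so that one induction along T yields
    the bound and another one the geometric rate of convergence. *)
Lemma cohomological_equation (X : topologicalType) (T : X -> X) (phi : X -> R)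
    (c : R) (d : nat) : (2 <= d)%N -> continuous T -> continuous phi ->
  (forall x, `|phi x| <= c) ->
  exists g : X -> R, [/\ continuous g, forall x, `|g x| <= c &
    forall x, d%:R * g x = phi x + g (T x)].
Proof.
move=> d2 cT cphi phic.
have d0 : 0 < d%:R :> R by rewrite ltr0n; exact: leq_trans d2.
have d2' : 2 <= d%:R :> R by rewrite (ler_nat _ 2).
pose gn := fix gn (n : nat) (x : X) : R :=
  if n is m.+1 then (phi x + gn m (T x)) / d%:R else 0.
have gnS n x : gn n.+1 x * d%:R = phi x + gn n (T x) by rewrite /= divfK// gt_eqF.
have gn_cont n : continuous (gn n).
  elim: n => [|n IH] x /=; first exact: cvg_cst.
  apply: cvgMl; apply: cvgD; first exact: cphi.
  by apply: (@continuous_comp _ _ _ T (gn n)); [exact: cT|exact: IH].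
have gn_bound n x : `|gn n x| <= c.
  elim: n x => [|n IH] x /=.
    by rewrite normr0 (le_trans _ (phic x)).
  rewrite normrM normfV [X in _ / X]gtr0_norm// ler_pdivrMr//.
  apply: le_trans (ler_normD _ _) _; apply: le_trans (lerD (phic x) (IH _)) _.
  have c0 : 0 <= c by rewrite (le_trans _ (phic x)).
  by have := ler_wpM2l c0 d2'; lra.
(* the operator g |-> (phi + g o T) / d contracts uniform distances by 1 / d *)
have gn_cauchy n m x : `|gn (n + m)%N x - gn n x| <= c / d%:R ^+ n.
  elim: n x => [|n IH] x; first by rewrite add0n subr0 expr0 divr1.
  rewrite addSn /= -mulrBl normrM normfV [X in _ / X]gtr0_norm// exprSr invfM mulrA.
  by rewrite ler_pM2r ?invr_gt0// opprD addrACA subrr add0r.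
have gcvg x : cvgn (gn ^~ x).
  apply/cauchy_cvgP/cauchy_exP => e e0.
  have [N HN] := eventually_lt_geometric c d2 e0.
  exists (gn N x); exists N => // m /= Nm.
  rewrite /ball /= distrC -(subnKC Nm); apply: le_lt_trans (HN N (leqnn N)).
  exact: gn_cauchy.
pose g x := limn (gn ^~ x).
have gE n x : `|g x - gn n x| <= c / d%:R ^+ n.
  apply/ler_addgt0Pr => e e0.
  have [N _ HN] : \forall m \near \oo, `|g x - gn m x| < e.
    by move/cvgrPdist_lt : (gcvg x) => /(_ e e0).
  have h1 := HN (n + N)%N (leq_addl _ _); have h2 := gn_cauchy n N x.
  have -> : g x - gn n x = (gn (n + N)%N x - gn n x) + (g x - gn (n + N)%N x) by ring.
  by apply: le_trans (ler_normD _ _) _; rewrite lerD// ltW.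
exists g; split=> [x|x|x].
- apply/cvgrPdist_lt => e e0; have e30 : 0 < e / 3 by rewrite divr_gt0.
  have [N HN] := eventually_lt_geometric c d2 e30.
  have : \forall y \near x, `|gn N x - gn N y| < e / 3.
    by move/cvgrPdist_lt : (@gn_cont N x) => /(_ _ e30).
  apply: filterS => y xy.
  have -> : g x - g y = (g x - gn N x) + (gn N x - gn N y) - (g y - gn N y) by ring.
  have hN := HN N (leqnn N); have gx := gE N x; have gy := gE N y.
  apply: le_lt_trans (ler_normB _ _) _.
  apply: le_lt_trans (lerD (ler_normD _ _) (lexx _)) _; lra.
- by have := gE 0%N x; rewrite /= subr0 expr0 divr1.
- apply/eqP; rewrite -subr_eq0 -normr_le0; apply/ler_addgt0Pr => e e0.
  have [N HN] := eventually_lt_geometric (c + c) d2 e0.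
  have hN := HN N (leqnn N); have g1 := gE N.+1 x; have g2 := gE N (T x).
  have -> : d%:R * g x - (phi x + g (T x)) =
     d%:R * (g x - gn N.+1 x) - (g (T x) - gn N (T x)).
    by have := gnS N x; lra.
  rewrite add0r; apply: le_trans (ler_normB _ _) _.
  rewrite normrM gtr0_norm//.
  have : d%:R * `|g x - gn N.+1 x| <= c / d%:R ^+ N.
    rewrite -ler_pdivlMl//; apply: le_trans g1 _.
    by rewrite exprS invfM mulrCA.
  move=> h; apply: le_trans (lerD h g2) _; rewrite -mulrDl; exact: ltW.
Qed.

End CohomologicalEquation.

(** * The Green functions *)

Lemma continuous_pair (X Y Z : topologicalType) (f : X -> Y) (g : X -> Z) (x : X) :
  {for x, continuous f} -> {for x, continuous g} ->
  {for x, continuous (fun t => (f t, g t))}.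
Proof. by move=> cf cg; exact: cvg_pair cf cg. Qed.

Lemma near_cvgeNy (R : realType) (T : topologicalType) (u : T -> \bar R) (x : T) :
  (forall A : R, \forall y \near x, (u y <= A%:E)%E) ->
  u y @[y --> x] --> -oo%E.
Proof. by move=> H; apply/cvgeNyPle. Qed.

Lemma near_cvgEFin (R : realType) (T : topologicalType) (u : T -> \bar R)
    (h : T -> R) (x : T) :
  {for x, continuous h} -> (\forall y \near x, u y = (h y)%:E) ->
  u y @[y --> x] --> (h x)%:E.
Proof.
move=> ch uh; have : (h y)%:E @[y --> x] --> (h x)%:E.
  by apply/fine_cvgP; split; [exact: nearW|exact: ch].
by apply: cvg_trans; apply: near_eq_cvg; apply: filterS uh => y ->.
Qed.

Section GreenFunction.
Variables (R : realType) (M : metricType R) (k d : nat).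
Local Notation C := (Cfield R).
Local Notation V := (Cvec R k).
Local Notation P := (projspace R k).
Variables (sigma : M -> M) (f : M -> P -> P) (F : M -> V -> V).
Hypothesis hd : (2 <= d)%N.
Hypothesis hF : forall lam, homogeneous_lift d (f lam) (F lam).
Implicit Types (lam : M) (x y : V).

Lemma lift0 lam : F lam 0 = 0.
Proof.
have : (F lam @^-1` [set 0]) 0 by rewrite (lift_nondegenerate (hF lam)).
by [].
Qed.

Lemma lift_neq0 lam x : x != 0 -> F lam x != 0.
Proof.
apply: contra => /eqP Fx0; apply/eqP.
have : (F lam @^-1` [set 0]) x by [].
by rewrite (lift_nondegenerate (hF lam)).
Qed.

Lemma f_line lam x : x != 0 -> f lam (line x) = line (F lam x).
Proof.
move=> x0; rewrite (line_to_nonzero x0) (line_to_nonzero (lift_neq0 lam x0)).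
by rewrite -(lift_proj (hF lam) (x := to_nonzero x0) (y := to_nonzero (lift_neq0 lam x0))).
Qed.

Definition skew (p : M * P) : M * P := (sigma p.1, f p.1 p.2).

(** The logarithmic distortion of the norm by the lift.  By homogeneity the
    choice of a representative is immaterial. *)
Definition distortion (p : M * P) : R :=
  ln (eucl_norm (F p.1 (val (repr p.2)))) - d%:R * ln (eucl_norm (val (repr p.2))).

Lemma distortion_line lam x : x != 0 ->
  distortion (lam, line x) = ln (eucl_norm (F lam x)) - d%:R * ln (eucl_norm x).
Proof.
move=> x0; rewrite /distortion /=.
set y := repr (line x).
have : line (val y) = line x by rewrite lineE; exact: reprK.
move=> /(line_eqP (nonzeroP y) x0)[c c0 ->].
rewrite (lift_homogeneous (hF lam)) !eucl_normZ normcX.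
have nc : 0 < normc (c : R[i]) by rewrite (@normc_gt0 R).
have nx : 0 < eucl_norm x by rewrite eucl_norm_gt0.
have nF : 0 < eucl_norm (F lam x) by rewrite eucl_norm_gt0 lift_neq0.
rewrite !lnM ?posrE ?exprn_gt0// lnXn// -mulr_natl; ring.
Qed.

Section Continuity.
Hypothesis hM : compact [set: M].
Hypothesis hsigma : continuous sigma.
Hypothesis hfcont : continuous (fun p : M * P => f p.1 p.2).
Hypothesis hFcont : continuous (fun p : M * V => eucl_norm (F p.1 p.2)).

Lemma skew_continuous : continuous skew.
Proof.
move=> p; apply: continuous_pair; last exact: hfcont.
by apply: (@continuous_comp _ _ _ fst sigma); [exact: cvg_fst|exact: hsigma].
Qed.

Lemma log_lift_continuous lam x : x != 0 ->
  {for (lam, x), continuous (fun p : M * V => ln (eucl_norm (F p.1 p.2)))}.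
Proof.
move=> x0; apply: (@continuous_comp _ _ _ (fun p : M * V => eucl_norm (F p.1 p.2)) (@ln R)).
  exact: hFcont.
by apply: continuous_ln; rewrite eucl_norm_gt0 lift_neq0.
Qed.

Lemma ln_eucl_continuous x : x != 0 ->
  {for x, continuous (fun y : V => ln (eucl_norm y))}.
Proof.
move=> x0; apply: (@continuous_comp _ _ _ (@eucl_norm R k) (@ln R)).
  exact: eucl_norm_continuous.
by apply: continuous_ln; rewrite eucl_norm_gt0.
Qed.

Lemma distortion_continuous : continuous distortion.
Proof.
apply: continuous_on_projspace => lam x x0.
pose h (p : M * V) := ln (eucl_norm (F p.1 p.2)) - d%:R * ln (eucl_norm p.2).
have hc : {for (lam, x), continuous h}.
  apply: cvgB; first exact: log_lift_continuous.
  apply: cvgMr.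
  apply: (@continuous_comp _ _ _ snd (fun y : V => ln (eucl_norm y))).
    exact: cvg_snd.
  exact: ln_eucl_continuous.
have near_h : \forall p \near (lam, x), distortion (p.1, line p.2) = h p.
  have nx : \forall p \near ((lam, x) : M * V), p.2 != 0.
    exists (setT, [set y : V | y != 0]) => [|[m y] [] //].
    by split; [exact: filterT|exact: nbhs_neq0].
  by apply: filterS nx => p; exact: distortion_line.
move=> A; rewrite /= distortion_line// => hA.
have := hc A hA; move: near_h => /filterI/[apply].
by apply: filterS => p [/= -> ].
Qed.

Lemma distortion_bounded : exists c, forall p, `|distortion p| <= c.
Proof.
pose S : set (M * V) := [set: M] `*` [set x | eucl_norm x = 1].
have cS : compact S by apply: compact_setX => //; exact: compact_sphere.
have hc : {within S, continuous (fun p : M * V => ln (eucl_norm (F p.1 p.2)))}.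
  apply: continuous_in_subspaceT => -[lam x] /[!inE] -[_ /= x1].
  by apply: log_lift_continuous; rewrite -eucl_norm_gt0 x1.
have /compact_bounded[c [_ Hc]] := continuous_compact hc cS.
exists (c + 1) => -[lam p]; have [x x0 <-] := line_surj p.
have nx : 0 < eucl_norm x by rewrite eucl_norm_gt0.
pose r : C := ((eucl_norm x)^-1)%:C%C.
have nr : normc (r : R[i]) = (eucl_norm x)^-1.
  by rewrite /r normcR ger0_norm// invr_ge0 ltW.
have r0 : r != 0 by rewrite -(@normc_gt0 R) nr invr_gt0.
have y1 : eucl_norm (r *: x) = 1 by rewrite eucl_normZ nr mulVf// gt_eqF.
have y0 : r *: x != 0 by rewrite -eucl_norm_gt0 y1.
rewrite -(lineZ x r0) distortion_line// y1 ln1 mulr0 subr0.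
apply: (Hc (c + 1)); first by rewrite ltrDl.
by exists (lam, r *: x).
Qed.

End Continuity.

(* g stands for the bounded solution of the cohomological equation *)
Variables (g : M * P -> R) (c : R).
Hypothesis g_cont : continuous g.
Hypothesis g_bound : forall p, `|g p| <= c.
Hypothesis g_eq : forall p, d%:R * g p = distortion p + g (skew p).

Definition green_fin lam x : R := ln (eucl_norm x) + g (lam, line x).

Definition green lam x : \bar R := if x == 0 then -oo%E else (green_fin lam x)%:E.

Lemma green0 lam : green lam 0 = -oo%E.
Proof. by rewrite /green eqxx. Qed.

Lemma green_neq0 lam x : x != 0 -> green lam x = (green_fin lam x)%:E.
Proof. by rewrite /green => /negbTE ->. Qed.

Lemma green_finZ lam (a : C) x : a != 0 -> x != 0 ->
  green_fin lam (a *: x) = ln (normc (a : R[i])) + green_fin lam x.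
Proof.
move=> a0 x0; rewrite /green_fin lineZ// eucl_normZ lnM ?addrA//.
  by rewrite posrE (@normc_gt0 R).
by rewrite posrE eucl_norm_gt0.
Qed.

Lemma greenZ lam (a : C) x : a != 0 ->
  green lam (a *: x) = ((ln (normc (a : R[i])))%:E + green lam x)%E.
Proof.
move=> a0; have [->|x0] := eqVneq x 0; first by rewrite scaler0 green0.
by rewrite !green_neq0 ?scaler_eq0 ?negb_or ?a0// green_finZ.
Qed.

Lemma green_fin_lift lam x : x != 0 ->
  green_fin (sigma lam) (F lam x) = d%:R * green_fin lam x.
Proof.
move=> x0; rewrite /green_fin mulrDr g_eq distortion_line// /skew /= f_line//.
ring.
Qed.

Lemma green_lift lam x : (d%:R%:E * green lam x = green (sigma lam) (F lam x))%E.
Proof.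
have d0 : 0 < d%:R :> R by rewrite ltr0n; exact: leq_trans hd.
have [->|x0] := eqVneq x 0; first by rewrite lift0 !green0 gt0_muleNy.
by rewrite !green_neq0 ?lift_neq0// green_fin_lift// EFinM.
Qed.

Lemma fiber_iterS lam n x :
  fiber_iter sigma F lam n.+1 x = F (iter n sigma lam) (fiber_iter sigma F lam n x).
Proof. by []. Qed.

Lemma fiber_iter0 lam n : fiber_iter sigma F lam n 0 = 0.
Proof. by elim: n => [//|n IH]; rewrite fiber_iterS IH lift0. Qed.

Lemma fiber_iter_neq0 lam n x : x != 0 -> fiber_iter sigma F lam n x != 0.
Proof. by move=> x0; elim: n => [//|n IH]; rewrite fiber_iterS lift_neq0. Qed.

Lemma green_fin_iter lam n x : x != 0 ->
  green_fin (iter n sigma lam) (fiber_iter sigma F lam n x) =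
  d%:R ^+ n * green_fin lam x.
Proof.
move=> x0; elim: n => [|n IH]; first by rewrite mul1r.
by rewrite fiber_iterS iterS green_fin_lift ?fiber_iter_neq0// IH exprS mulrA.
Qed.

(** By the functional equation d^n G x is the value of the Green function at the
    n-th iterate, where it differs from the logarithm of the norm by a value
    of g. *)
Lemma ln_fiber_iter_approx lam n x : x != 0 ->
  `|ln (eucl_norm (fiber_iter sigma F lam n x)) - d%:R ^+ n * green_fin lam x| <= c.
Proof.
move=> x0; rewrite -green_fin_iter// /green_fin opprD addrA subrr add0r normrN.
exact: g_bound.
Qed.

Lemma green_approx_cvg lam :
  uniform_cvg_on [set: V] (fun n => green_approx sigma F d n lam) (green lam).
Proof.
move=> e e0; have [N HN] := eventually_lt_geometric c hd e0.
exists N => // n /= /HN cn x _; rewrite /green_approx.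
have dn : 0 < d%:R ^+ n :> R by rewrite exprn_gt0// ltr0n; exact: leq_trans hd.
have [->|x0] := eqVneq x 0.
  rewrite fiber_iter0 eucl_norm0 green0 /= lexx gt0_muleNy ?lte_fin ?invr_gt0//.
rewrite lne_EFin ?eucl_norm_gt0 ?fiber_iter_neq0// green_neq0//.
have := ln_fiber_iter_approx lam n x0.
set a := ln _; set b := green_fin _ _ => ab.
have : `|(d%:R ^+ n)^-1 * a - b| < e.
  apply: le_lt_trans cn; rewrite ler_pdivlMr//.
  rewrite -{2}(gtr0_norm dn) -normrM mulrBl mulrAC mulVf ?gt_eqF// mul1r.
  by rewrite [b * _]mulrC.
rewrite -EFinM -!EFinD !lee_fin ltr_norml => /andP[h1 h2].
split; lra.
Qed.

Lemma green_fin_continuous lam0 x : x != 0 ->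
  {for (lam0, x), continuous (fun p : M * V => green_fin p.1 p.2)}.
Proof.
move=> x0; apply: cvgD.
  apply: (@continuous_comp _ _ _ snd (fun y : V => ln (eucl_norm y))).
    exact: cvg_snd.
  exact: ln_eucl_continuous.
apply: (@continuous_comp _ _ _ (fun p : M * V => (p.1, line p.2)) g); last exact: g_cont.
apply: continuous_pair; first exact: cvg_fst.
apply: (@continuous_comp _ _ _ snd (@line R k)); first exact: cvg_snd.
exact: line_continuous.
Qed.

Lemma green_le lam x : x != 0 -> green_fin lam x <= ln (eucl_norm x) + c.
Proof.
by move=> x0; rewrite lerD2l; have := g_bound (lam, line x); rewrite ler_norml => /andP[].
Qed.

Lemma green_continuous lam : continuous (green lam).
Proof.
move=> x; have [->|x0] := eqVneq x 0.
  rewrite /continuous_at green0; apply: near_cvgeNy => A.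
  have : \forall y \near (0 : V), eucl_norm y < expR (A - c).
    have := @eucl_norm_continuous R k 0; rewrite /continuous_at eucl_norm0.
    by move/cvgr_lt; apply; exact: expR_gt0.
  have small (y : V) : eucl_norm y < expR (A - c) -> (green lam y <= A%:E)%E.
    move=> yA; have [->|y0] := eqVneq y 0; first by rewrite green0 leNye.
    rewrite green_neq0// lee_fin; apply: le_trans (green_le lam y0) _.
    rewrite -lerBrDr -[leRHS]expRK ler_ln ?posrE ?expR_gt0 ?eucl_norm_gt0//.
    exact: ltW.
  by apply: filterS => y; exact: small.
rewrite /continuous_at green_neq0//.
have cG : {for x, continuous (green_fin lam)}.
  apply: (@continuous_comp _ _ _ (fun y : V => (lam, y)) (fun p : M * V => green_fin p.1 p.2)).
    by apply: continuous_pair; [exact: cst_continuous|exact: cvg_id].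
  exact: green_fin_continuous.
apply: near_cvgEFin cG _.
by apply: filterS (nbhs_neq0 x0) => y /(green_neq0 lam).
Qed.

(** On the unit sphere the convergence is uniform by compactness; as the
    difference of two Green functions is homogeneous of degree 0, it is then
    uniform on the complement of the origin. *)
Lemma green_cvg_parameter (lams : nat -> M) lam : lams n @[n --> \oo] --> lam ->
  locally_uniform_cvg_on [set x : V | x != 0] (fun n => green (lams n)) (green lam).
Proof.
move=> lamsE x0 _; exists setT; first exact: filterT.
move=> e e0; have e20 : 0 < e / 2 by rewrite divr_gt0.
have : \forall m \near lam, [set x : V | eucl_norm x = 1] `<=`
    [set x : V | `|green_fin m x - green_fin lam x| < e].
  have /compact_near_coveringP cov := @compact_sphere R k.
  apply: (cov M (nbhs lam) (fun m x => `|green_fin m x - green_fin lam x| < e)).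
  move=> x x1; have xn0 : x != 0 by rewrite -eucl_norm_gt0 x1.
  have /cvgrPdist_lt/(_ _ e20)[[U W]/= [lU xW] UW] := @green_fin_continuous lam x xn0.
  exists (W, U) => //= -[y m] /= [Wy Um].
  have h1 : `|green_fin lam x - green_fin m y| < e / 2 := UW (m, y) (conj Um Wy).
  have h2 : `|green_fin lam x - green_fin lam y| < e / 2 :=
    UW (lam, y) (conj (nbhs_singleton lU) Wy).
  have -> : green_fin m y - green_fin lam y =
    (green_fin lam x - green_fin lam y) - (green_fin lam x - green_fin m y) by ring.
  by apply: le_lt_trans (ler_normB _ _) _; lra.
move=> /lamsE [N _ HN]; exists N => // n /HN Hn x [_ xn0].
have nx : 0 < eucl_norm x by rewrite eucl_norm_gt0.
pose r : C := ((eucl_norm x)^-1)%:C%C.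
have nr : normc (r : R[i]) = (eucl_norm x)^-1.
  by rewrite /r normcR ger0_norm// invr_ge0 ltW.
have r0 : r != 0 by rewrite -(@normc_gt0 R) nr invr_gt0.
have y1 : eucl_norm (r *: x) = 1 by rewrite eucl_normZ nr mulVf// gt_eqF.
have : `|green_fin (lams n) (r *: x) - green_fin lam (r *: x)| < e := Hn _ y1.
rewrite !green_finZ// opprD addrACA subrr add0r.
rewrite !green_neq0// -!EFinD !lee_fin ltr_norml => /andP[h1 h2].
split; lra.
Qed.

(** By [ln_fiber_iter_approx], ln |F^n x| tends to -oo exactly when d^n G x
    does, that is, when G x < 0. *)
Lemma basin_green lam : basin sigma F lam = [set x | (green lam x < 0)%E].
Proof.
have d0 : 0 < d%:R :> R by rewrite ltr0n; exact: leq_trans hd.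
apply/seteqP; split => x /=.
  rewrite /basin /= => bx; have [->|x0] := eqVneq x 0; first by rewrite green0 ltNy0.
  rewrite green_neq0// lte_fin ltNge; apply/negP => G0.
  have : \forall n \near \oo, eucl_norm (fiber_iter sigma F lam n x) < expR (- c).
    have b0 : eucl_norm (fiber_iter sigma F lam n x) @[n --> \oo] --> (0 : R).
      rewrite -(@eucl_norm0 R k); apply: (cvg_comp _ _ bx).
      exact: eucl_norm_continuous.
    exact: cvgr_lt b0 _ (expR_gt0 _).
  move=> [n _ /(_ n (leqnn n)) /= hn].
  have := ln_fiber_iter_approx lam n x0; rewrite ler_norml => /andP[+ _].
  have : 0 <= d%:R ^+ n * green_fin lam x by rewrite mulr_ge0// exprn_ge0// ltW.
  have : ln (eucl_norm (fiber_iter sigma F lam n x)) < - c.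
    rewrite -[ltRHS]expRK ltr_ln ?posrE ?expR_gt0 ?eucl_norm_gt0//.
    exact: fiber_iter_neq0.
  lra.
have [->|x0] := eqVneq x 0.
  move=> _ A A0; exists 0%N => // n _ /=.
  by rewrite fiber_iter0; exact: nbhs_singleton A0.
rewrite green_neq0// lte_fin => G0 A /nbhs0_eucl[e e0 eA].
have G0' : 0 < - green_fin lam x by rewrite oppr_gt0.
have [N HN] := eventually_lt_geometric (`|ln e - c| + 1) hd G0'.
exists N => // n /= /HN h; apply: eA.
have dn : 0 < d%:R ^+ n :> R by rewrite exprn_gt0.
rewrite ltr_pdivrMr// in h.
have := ln_fiber_iter_approx lam n x0; rewrite ler_norml => /andP[_ h2].
rewrite -ltr_ln ?posrE ?eucl_norm_gt0 ?fiber_iter_neq0//.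
have := ler_norm (- (ln e - c)); rewrite normrN; lra.
Qed.

Lemma differentiable_fiber_iter lam n x : differentiable (fiber_iter sigma F lam n) x.
Proof.
elim: n => [|n IH]; first exact: ex_diff.
exact: (differentiable_comp IH (lift_holomorphic (hF _) _)).
Qed.

Lemma differentiable_affine (a b : V) (z : C) :
  differentiable (fun z : C => a + z *: b) z.
Proof.
apply: differentiableD; first exact: differentiable_cst.
by apply: differentiableZl; exact: ex_diff.
Qed.

(** [discrete_jensen] for the n-th iterate, divided by N d^n.  Replacing the
    logarithms of the iterates by Green functions costs 2 c / d^n, and the
    factor q = 1/e of the maximum principle at most 1 / d^n. *)
Lemma green_discrete_submean lam (a b : V) (N : nat) (e : R) : a != 0 ->
  (0 < N)%N -> 0 < e -> exists2 t : R, 0 <= t <= 2 * pi &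
    let x j := a + (cis (t + 2 * pi / N%:R * j%:R) : C) *: b in
    (forall j : 'I_N, x j != 0) /\
    green_fin lam a <= N%:R^-1 * \sum_(j < N) green_fin lam (x j) + e.
Proof.
move=> a0 N0 e0.
have [n0 Hn] := eventually_lt_geometric (2 * c + 1) hd e0.
have {Hn} := Hn n0 (leqnn n0); move: n0 => n Hn.
pose h (z : C) := fiber_iter sigma F lam n (a + z *: b).
have dh z : differentiable h z.
  apply: (@differentiable_comp _ _ _ _ (fun z : C => a + z *: b)).
    exact: differentiable_affine.
  exact: differentiable_fiber_iter.
have h0E : h 0 = fiber_iter sigma F lam n a by rewrite /h scale0r addr0.
have h0 : h 0 != 0 by rewrite h0E fiber_iter_neq0.
have q0 : 0 < expR (-1) :> R := expR_gt0 _.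
have q1 : expR (-1) < 1 :> R by rewrite expR_lt1 ltrN10.
have [t tp jensen] := discrete_jensen N dh h0 q0 q1.
exists t => // x.
have nh0 : 0 < eucl_norm (h 0) by rewrite eucl_norm_gt0.
have prod0 : 0 < \prod_(j < N) eucl_norm (h (cis (t + 2 * pi / N%:R * j%:R))).
  by apply: lt_le_trans jensen; rewrite mulr_gt0// exprn_gt0.
have xn0 (j : 'I_N) : x j != 0.
  apply/eqP => xj0; move: prod0; rewrite (bigD1 j)//= {1}/h -/(x j) xj0.
  by rewrite fiber_iter0 eucl_norm0 mul0r ltxx.
split=> //.
have dn : 0 < d%:R ^+ n :> R by rewrite exprn_gt0// ltr0n; exact: leq_trans hd.
have lnprod : ln (\prod_(j < N) eucl_norm (h (cis (t + 2 * pi / N%:R * j%:R)))) =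
    \sum_(j < N) ln (eucl_norm (fiber_iter sigma F lam n (x j))).
  pose Q (p s : R) := 0 < p /\ ln p = s.
  suff : Q (\prod_(j < N) eucl_norm (h (cis (t + 2 * pi / N%:R * j%:R))))
    (\sum_(j < N) ln (eucl_norm (fiber_iter sigma F lam n (x j)))) by case.
  apply: (big_rec2 Q) => [|j p s _ [s0 <-]]; first by split; [|exact: ln1].
  have xj0 : 0 < eucl_norm (fiber_iter sigma F lam n (x j)).
    by rewrite eucl_norm_gt0 fiber_iter_neq0.
  by split; [rewrite mulr_gt0|rewrite lnM].
have N0' : 0 < N%:R :> R by rewrite ltr0n.
have lnineq : -1 + N%:R * ln (eucl_norm (h 0)) <=
    \sum_(j < N) ln (eucl_norm (fiber_iter sigma F lam n (x j))).
  rewrite -lnprod; have : expR (-1) * eucl_norm (h 0) ^+ N \is Num.pos.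
    by rewrite posrE mulr_gt0// exprn_gt0.
  move=> /ler_ln/(_ prod0); rewrite jensen lnM ?posrE ?exprn_gt0// expRK lnXn//.
  by rewrite -[_ *+ N]mulr_natl.
have up : \sum_(j < N) ln (eucl_norm (fiber_iter sigma F lam n (x j))) <=
    d%:R ^+ n * \sum_(j < N) green_fin lam (x j) + N%:R * c.
  rewrite mulr_sumr.
  apply: (@le_trans _ _ (\sum_(j < N) (d%:R ^+ n * green_fin lam (x j) + c))).
    apply: ler_sum => j _; have := ln_fiber_iter_approx lam n (xn0 j).
    by rewrite ler_norml => /andP[_]; rewrite lerBlDr addrC.
  by rewrite big_split/= sumr_const card_ord mulr_natl.
have low : d%:R ^+ n * green_fin lam a - c <= ln (eucl_norm (h 0)).
  have := ln_fiber_iter_approx lam n a0; rewrite -h0E ler_norml => /andP[+ _].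
  by rewrite lerBrDr addrC.
set S := \sum_(j < N) green_fin lam (x j) in up *.
have N1 : 1 <= N%:R :> R by rewrite (ler_nat _ 1).
have low' := ler_wpM2l (ltW N0') low.
rewrite ltr_pdivrMr// in Hn.
have Ne := ler_wpM2l (ltW N0') (ltW Hn).
rewrite -(ler_pM2l dn) -(ler_pM2l N0').
rewrite (_ : N%:R * (d%:R ^+ n * (N%:R^-1 * S + e)) =
  d%:R ^+ n * S + N%:R * (e * d%:R ^+ n)); last by field; rewrite gt_eqF.
lra.
Qed.

Lemma green_plurisubharmonic lam : plurisubharmonic (green lam).
Proof.
have lty x : (green lam x < +oo)%E.
  have [->|x0] := eqVneq x 0; first by rewrite green0.
  by rewrite green_neq0// ltry.
split=> //.
- by exists (const_mx 1); rewrite green_neq0// const1_neq0.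
- move=> x r; rewrite lteNr => rx; exists [set y | (green lam y < - r%:E)%E].
    have : nbhs (green lam x) [set z | (z < - r%:E)%E].
      by apply: open_nbhs_nbhs; split => //; exact: open_ereal_lt_ereal.
    by move/(@green_continuous lam x).
  by move=> y /=; rewrite lteNr.
move=> a b; have [->|a0] := eqVneq a 0; first by rewrite green0 leNye.
rewrite green_neq0//.
pose gam (t : R) : V := a + (cis t : C) *: b.
have gamc : continuous gam.
  move=> t; apply: (@continuous_comp _ _ _ (fun t => cis t : C) (fun z : C => a + z *: b)).
    by apply: continuous_Complex; [exact: continuous_cos|exact: continuous_sin].
  exact/differentiable_continuous/differentiable_affine.
have ab0 : 0 < eucl_norm a + eucl_norm b.
  by rewrite ltr_pwDl ?eucl_norm_ge0 ?eucl_norm_gt0.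
apply: (@submean_of_truncations R (fun t => green lam (gam t)) _
  (ln (eucl_norm a + eucl_norm b) + c)).
- move=> t; have [->|y0] := eqVneq (gam t) 0; first by rewrite green0 leNye.
  rewrite green_neq0// lee_fin; apply: le_trans (green_le lam y0) _.
  rewrite lerD2r ler_ln ?posrE ?eucl_norm_gt0//.
  apply: le_trans (eucl_normDZ _ _ _) _.
  by rewrite /cis /= cos2Dsin2 sqrtr1 mul1r.
- move=> K; apply: trunc_continuous => // t.
  by apply: continuous_comp; [exact: gamc|exact: green_continuous].
- by move=> t; rewrite /gam /cis mulr_natl cosD2pi sinD2pi.
move=> N e N0 e0; have [t tp [xn0 H]] := green_discrete_submean lam b a0 N0 e0.
exists t => // K; apply: le_trans H _.
rewrite lerD2r ler_wpM2l ?invr_ge0// ler_sum// => j _.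
rewrite /gam green_neq0; last exact: xn0.
by rewrite /trunc -EFin_max /= le_max lexx.
Qed.

End GreenFunction.

(* A lift F_lam is determined by f_lam up to a factor in C^*, and continuity of
   f in lam does not constrain that factor; [hFcont] does (its modulus).  It
   holds as soon as (lam, x) |-> F_lam(x) is continuous. *)
Theorem proposition1p6 (R : realType) (M : metricType R) (k d : nat)
    (sigma : M -> M) (f : M -> projspace R k -> projspace R k)
    (F : M -> Cvec R k -> Cvec R k)
    (hM : compact [set: M])
    (hsigma : continuous sigma)
    (hd : (2 <= d)%N)
    (hfhol : forall lam : M, holomorphic_endo (f lam))
    (hfcont : continuous (fun p : M * projspace R k => f p.1 p.2))
    (hF : forall lam : M, homogeneous_lift d (f lam) (F lam))
    (hFcont : continuous (fun p : M * Cvec R k => eucl_norm (F p.1 p.2))) :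
  exists G : M -> Cvec R k -> \bar R,
    (forall lam : M,
      [/\ uniform_cvg_on [set: Cvec R k]
            (fun n => green_approx sigma F d n lam) (G lam),
          continuous (G lam),
          plurisubharmonic (G lam),
          G lam 0 = -oo%E &
          forall (c : Cfield R) (x : Cvec R k), c != 0 ->
            G lam (c *: x) = ((ln (Normc.normc c))%:E + G lam x)%E]) /\
    (forall (lam : M) (x : Cvec R k),
      ((d%:R)%:E * G lam x = G (sigma lam) (F lam x))%E) /\
    (forall (lams : nat -> M) (lam : M), lams n @[n --> \oo] --> lam ->
      locally_uniform_cvg_on [set x : Cvec R k | x != 0]
        (fun n => G (lams n)) (G lam)) /\
    (forall lam : M, basin sigma F lam = [set x | (G lam x < 0)%E]).
Proof.
have skewc := skew_continuous hsigma hfcont.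
have distc := distortion_continuous hF hFcont.
have [c distb] := distortion_bounded hF hM hFcont.
have [g [g_cont g_bound g_eq]] := cohomological_equation hd skewc distc distb.
exists (green g); split; [|split; [|split]].
- move=> lam; split.
  + exact (green_approx_cvg hd hF g_bound g_eq lam).
  + exact: (green_continuous g_cont g_bound).
  + exact (green_plurisubharmonic hd hF g_cont g_bound g_eq lam).
  + exact: green0.
  + by move=> a x a0; exact: greenZ.
- exact (green_lift hd hF g_eq).
- exact (green_cvg_parameter g_cont).
- exact (basin_green hd hF g_bound g_eq).
Qed.
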